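(* Let $k\ge2$ and let $\nu_{k-1}\in\ell^1$ be generic (all entries nonzero). Define $\Phi^{\nu_{k-1}}:GI^\infty_{+,0,k-1}\to\ell^\infty\times\ell^1$ by $$\Phi^{\nu_{k-1}}(g)=\big(\log g_0,\ g_{k-1}g_0^{-1}\nu_{k-1}-\tilde s^{k-1}(g_{k-1}g_0^{-1}\nu_{k-1})\big),$$ let $\pi:GI^\infty_{+,0,k-1}\to GI^\infty_{+,0,k-1}/GL_0^{\infty,k-1}$ be the canonical projection, $\iota_{\nu_{k-1}}:GI^\infty_{+,0,k-1}/GL_0^{\infty,k-1}\to(\delta^k)^{-1}(\Delta_{\nu_{k-1}})$, $\iota_{\nu_{k-1}}([g])=(\operatorname{Ad}^{+,k})^*_{g^{-1}}\big((S^T)^{k-1}\nu_{k-1}\big)$, and $$\mathcal J_{\nu_{k-1}}:\ell^\infty\times\ell^1\to(\delta^k)^{-1}(\Delta_{\nu_{k-1}}),\quad\mathcal J_{\nu_{k-1}}(\mathbf q,\mathbf p)=\mathbf p+(S^T)^{k-1}\nu_{k-1}e^{s^{k-1}(\mathbf q)-\mathbf q}.$$ Consider the diagram with first row $$1\to GL_0^{\infty,k-1}\to GI^\infty_{+,0,k-1}\xrightarrow{\ \pi\ }GI^\infty_{+,0,k-1}/GL_0^{\infty,k-1}\to1,$$ second row $$0\times\{\mathbf p\}\to L_0^{\infty,k-1}\times\{\mathbf p\}\to\ell^\infty\times\ell^1\xrightarrow{\ \mathcal J_{\nu_{k-1}}\ }(\delta^k)^{-1}(\Delta_{\nu_{k-1}})\to0,$$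 and vertical maps $\Phi^{\nu_{k-1}}:GI^\infty_{+,0,k-1}\to\ell^\infty\times\ell^1$ and $\iota_{\nu_{k-1}}:GI^\infty_{+,0,k-1}/GL_0^{\infty,k-1}\to(\delta^k)^{-1}(\Delta_{\nu_{k-1}})$. Then: - the diagram commutes: $\mathcal J_{\nu_{k-1}}\circ\Phi^{\nu_{k-1}}=\iota_{\nu_{k-1}}\circ\pi$; - the first row is an exact sequence of Banach Lie groups; - the second row is also exact in the following sense: the map $\mathcal J_{\nu_{k-1}}$ is onto and its level sets are all of the form $L_0^{\infty,k-1}\times\{\mathbf p\}$, where $\mathbf p\in L^1_0$; - $(\Phi^{\nu_{k-1}})^*\omega=\pi^*\omega_{\nu_{k-1}}$, where $\omega$ and $\omega_{\nu_{k-1}}$ are the weak symplectic forms on $\ell^\infty\times\ell^1$ and on $GI^\infty_{+,0,k-1}/GL_0^{\infty,k-1}$, respectively; - $\Phi^{\nu_{k-1}}\big(\pi^{-1}([g])\big)=\mathcal J_{\nu_{k-1}}^{-1}\big(\iota_{\nu_{k-1}}([g])\big)$ for any $g\in GI^\infty_{+,0,k-1}$.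
   Context: Let $\mathcal H$ be a real separable Hilbert space with orthonormal basis $\{|n\rangle\}_{n\ge0}$. Sequences in $\ell^\infty$ (resp. $\ell^1$) are identified with bounded (resp. trace class, denoted $L^1_0$) diagonal operators; products, exponentials and logarithms are componentwise. $S=\sum_{n\ge0}|n\rangle\langle n+1|$, $S^T$ its adjoint. For a diagonal operator $x=(x_0,x_1,\dots)$: $s(x)=(x_1,x_2,\dots)$, $\tilde s(x)=(0,x_0,x_1,\dots)$. $GI^\infty_{+,0,k-1}$ is the Banach Lie group of elements $g=g_0+g_{k-1}S^{k-1}$, $g_0,g_{k-1}\in\ell^\infty$, with entries of $g_0$ bounded below by a strictly positive number (depending on $g_0$), with product $g\circ_kh=g_0h_0+(g_0h_{k-1}+g_{k-1}s^{k-1}(h_0))S^{k-1}$ (the same formula defines $g\circ_kx$ for $x$ in the Lie algebra). $GL_0^{\infty,k-1}$ is its (central) subgroup of diagonal elements $g_0$ with $s^{k-1}(g_0)=g_0$, and $L_0^{\infty,k-1}=\{x\in\ell^\infty\mid s^{k-1}(x)=x\}$ its Lie algebra. The Lie algebra of $GI^\infty_{+,0,k-1}$ is $I^\infty_{+,0,k-1}=\{x_0+x_{k-1}S^{k-1}\mid x_0,x_{k-1}\in\ell^\infty\}$ with bracket $[x,y]_k=\big(x_{k-1}(s^{k-1}(y_0)-y_0)-y_{k-1}(s^{k-1}(x_0)-x_0)\big)S^{k-1}$. Its predual is $I^1_{-,0,k-1}=\{\rho_0+(S^T)^{k-1}\rho_{k-1}\mid\rho_0,\rho_{k-1}\in\ell^1\}$,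 on which $$(\operatorname{Ad}^{+,k})^*_{g^{-1}}\rho=\rho_0+g_0^{-1}g_{k-1}\rho_{k-1}-\tilde s^{k-1}(g_0^{-1}g_{k-1}\rho_{k-1})+(S^T)^{k-1}s^{k-1}(g_0)g_0^{-1}\rho_{k-1}.$$ $\delta^k(\rho_0+(S^T)^{k-1}\rho_{k-1})=(S^T)^{k-1}\rho_{k-1}$, and $\Delta_{\nu_{k-1}}=\{(S^T)^{k-1}s^{k-1}(g_0)g_0^{-1}\nu_{k-1}\}$, where $g_0$ ranges over the diagonal elements of $GI^\infty_{+,0,k-1}$. $\omega((\mathbf q,\mathbf p),(\mathbf q',\mathbf p'))=\sum_i(q_ip'_i-q'_ip_i)$ on $\ell^\infty\times\ell^1$. The weak symplectic form $\omega_{\nu_{k-1}}$ on $GI^\infty_{+,0,k-1}/GL_0^{\infty,k-1}$ is, with $\nu=(S^T)^{k-1}\nu_{k-1}$, $$\omega_{\nu_{k-1}}([g])\big(T_g\pi(g\circ_kx),T_g\pi(g\circ_ky)\big)=\operatorname{Tr}(\nu[x,y]_k),\qquad x,y\in I^\infty_{+,0,k-1},$$ where $g\circ_kx$ is the value at $g$ of the left invariant vector field generated by $x$.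
   Formalization: The level sets of J are shown to be the translates (q + L_0) × {p} rather than literally L_0 × {p}; the literal form fails, e.g. for k = 2 and q = (log 2, 0, 0, ...), where q is not in L_0. *)

(* Defs.v *)
From HB Require Import structures.
From mathcomp Require Import all_boot all_order all_algebra.
From mathcomp Require Import all_classical all_reals all_analysis.

Set Implicit Arguments.
Unset Strict Implicit.
Unset Printing Implicit Defensive.

Import Order.TTheory GRing.Theory Num.Theory.
Import numFieldNormedType.Exports.

Local Open Scope classical_set_scope.
Local Open Scope ring_scope.

HB.instance Definition _ (T U : pnbhsType) := Pointed.on (T * U)%type.
HB.instance Definition _ (T U : ptopologicalType) := Pointed.on (T * U)%type.
HB.instance Definition _ (T U : puniformType) := Pointed.on (T * U)%type.
Section prod_complete.
Context {T U : completeType}.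

Lemma prod_complete (F : set_system (T * U)%type) :
  ProperFilter F -> cauchy F -> cvg F.
Proof.
move=> FF Fc.
have c1 : cvg (fst @ F).
  apply: cauchy_cvg => A /= entA; rewrite near_simpl -near2E near_map2.
  apply: Fc; apply: filterS (prod_entP entA (@filterT _ _ (@entourage_filter U))).
  by move=> ? [].
have c2 : cvg (snd @ F).
  apply: cauchy_cvg => A /= entA; rewrite near_simpl -near2E near_map2.
  apply: Fc; apply: filterS (prod_entP (@filterT _ _ (@entourage_filter T)) entA).
  by move=> ? [].
apply/cvg_ex; exists (lim (fst @ F), lim (snd @ F)) => A [[B C] [/= B1 C1] BC].
have FB := c1 B B1; have FC := c2 C C1.
apply: (@filterS _ F _ ((fst @^-1` B) `&` (snd @^-1` C))); last exact: filterI.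
by move=> -[a b] [/= Ba Cb]; exact: BC.
Qed.

HB.instance Definition _ := Uniform_isComplete.Build (T * U)%type prod_complete.
End prod_complete.

HB.instance Definition _ (R : numFieldType) (T U : completeNormedModType R) :=
  Complete.on (T * U)%type.

Section linf_def.
Context {R : realType}.

Definition linf_pred : {pred nat -> R} :=
  fun x => `[< exists M, forall n, `|x n| <= M >].

Record linf := MkLinf { linf_val :> nat -> R; _ : linf_val \in linf_pred }.

HB.instance Definition _ := [isSub for linf_val].
HB.instance Definition _ := [Choice of linf by <:].

Lemma linfP (x : linf) : exists M, forall n, `|x n| <= M.
Proof. by apply/asboolP; exact: (valP x). Qed.

Lemma linf_submod : submod_closed linf_pred.
Proof.
split; first by apply/asboolP; exists 0 => n; rewrite normr0.
move=> a x y /asboolP[M xM] /asboolP[N yN]; apply/asboolP.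
exists (`|a| * M + N) => n; apply: (le_trans (ler_normD _ _)).
by rewrite lerD// normrM ler_wpM2l.
Qed.

HB.instance Definition _ := GRing.isSubmodClosed.Build R _ linf_pred linf_submod.
HB.instance Definition _ := [SubChoice_isSubLmodule of linf by <:].

Lemma linf_ext (x y : linf) : (forall n, x n = y n) -> x = y.
Proof. by move=> xy; apply/val_inj/funext. Qed.

Definition linf_norm (x : linf) : R := sup (range (fun n => `|x n|)).

Lemma linf_has_sup (x : linf) : has_sup (range (fun n => `|x n|)).
Proof.
split; first by exists `|x 0%N|, 0%N.
by have [M xM] := linfP x; exists M => _ [n _ <-].
Qed.

Lemma linf_norm_ub (x : linf) n : `|x n| <= linf_norm x.
Proof. by apply: ub_le_sup; [exact: (linf_has_sup x).2 | exists n]. Qed.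

Lemma linf_norm_le (x : linf) M : (forall n, `|x n| <= M) -> linf_norm x <= M.
Proof.
by move=> xM; apply: ge_sup; [exact: (linf_has_sup x).1 | move=> _ [n _ <-]].
Qed.

Lemma linf_normD (x y : linf) : linf_norm (x + y) <= linf_norm x + linf_norm y.
Proof.
apply: linf_norm_le => n; apply: (le_trans (ler_normD _ _)).
by rewrite lerD// linf_norm_ub.
Qed.

Lemma linf_normZ (a : R) (x : linf) : linf_norm (a *: x) = `|a| * linf_norm x.
Proof.
have le1 b (z : linf) : linf_norm (b *: z) <= `|b| * linf_norm z.
  by apply: linf_norm_le => n; rewrite normrM ler_wpM2l// linf_norm_ub.
apply/eqP; rewrite eq_le le1/=.
have [->|a0] := eqVneq a 0.
  by rewrite normr0 mul0r (le_trans _ (linf_norm_ub _ 0%N)).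
rewrite -ler_pdivlMl ?normr_gt0//.
by have := le1 a^-1 (a *: x); rewrite scalerA mulVf// scale1r normfV.
Qed.

Lemma linf_norm0 (x : linf) : linf_norm x = 0 -> x = 0.
Proof.
move=> x0; apply: linf_ext => n; apply/eqP.
by rewrite -normr_le0 -x0 linf_norm_ub.
Qed.

HB.instance Definition _ :=
  Lmodule_isNormed.Build R linf linf_normD linf_normZ linf_norm0.

Lemma linf_normE (x : linf) : `|x| = linf_norm x. Proof. by []. Qed.

Lemma linf_complete (F : set_system linf) : ProperFilter F -> cauchy F -> cvg F.
Proof.
move=> FF /cauchyP Fc.
have cn n : cvg ((fun x : linf => x n) @ F).
  apply: cauchy_cvg; apply/cauchyP => e e0.
  have [x Fx] := Fc e e0; exists (x n).
  apply: (@filterS _ F _ (ball x e)) => // y.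
  rewrite -!ball_normE /ball_/=; apply: le_lt_trans.
  exact: (linf_norm_ub (x - y)).
pose l n := lim ((fun x : linf => x n) @ F).
have key (e : R) (x : linf) : 0 < e -> F (ball x e) -> forall n, `|x n - l n| <= e.
  move=> e0 Fx n; apply/ler_addgt0Pr => d d0.
  have /cvgrPdist_lt/(_ d d0) ln := cn n.
  near F => y.
  have : ball x e y by near: y.
  rewrite -ball_normE /ball_/= linf_normE => xy.
  have yl : `|l n - y n| < d by near: y.
  have -> : x n - l n = (x - y) n - (l n - y n) by rewrite opprB addrA subrK.
  apply: (le_trans (ler_normB _ _)).
  by rewrite lerD ?(ltW yl)// (le_trans (linf_norm_ub _ _))// ltW.
have lP : l \in linf_pred.
  have [x Fx] := Fc 1 ltr01; have [M xM] := linfP x.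
  apply/asboolP; exists (M + 1) => n.
  have -> : l n = x n - (x n - l n) by rewrite opprB addrC subrK.
  by rewrite (le_trans (ler_normB _ _))// lerD// key.
apply/cvg_ex; exists (MkLinf lP); apply/cvgrPdist_le => e e0.
have e2 : 0 < e / 2 by rewrite divr_gt0.
have [x Fx] := Fc _ e2.
near=> y.
have : ball x (e / 2) y by near: y.
rewrite -ball_normE /ball_/= !linf_normE => xy.
apply: linf_norm_le => n.
have -> : (MkLinf lP - y) n = (x - y) n - (x n - l n).
  by rewrite opprB [RHS]addrC addrA subrK.
apply: (le_trans (ler_normB _ _)); rewrite [leRHS]splitr lerD//.
  by rewrite (le_trans (linf_norm_ub _ _))// ltW.
exact: key.
Unshelve. all: by end_near. Qed.

HB.instance Definition _ := Uniform_isComplete.Build linf linf_complete.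

End linf_def.
Arguments linf : clear implicits.

Section l1_def.
Context {R : realType}.

Definition l1_pred : {pred nat -> R} :=
  fun x => `[< cvgn (series (fun n => `|x n|)) >].

Record l1 := MkL1 { l1_val :> nat -> R; _ : l1_val \in l1_pred }.

HB.instance Definition _ := [isSub for l1_val].
HB.instance Definition _ := [Choice of l1 by <:].

Lemma l1P (x : l1) : cvgn (series (fun n => `|x n|)).
Proof. by apply/asboolP; exact: (valP x). Qed.

Lemma l1_domin (u v : nat -> R) : (forall n, `|u n| <= v n) ->
  cvgn (series v) -> cvgn (series (fun n => `|u n|)).
Proof.
move=> uv; apply: series_le_cvg => // n.
by apply: le_trans (uv n).
Qed.

Lemma l1_submod : submod_closed l1_pred.
Proof.
split.
  apply/asboolP; rewrite (_ : series _ = cst 0); first exact: is_cvg_cst.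
  by apply/funext => n; rewrite /series/= big1// => i _; rewrite normr0.
move=> a x y /asboolP xc /asboolP yc; apply/asboolP.
apply: (@l1_domin _ ((`|a| *: (fun n => `|x n|)) + (fun n => `|y n|))).
  by move=> n; rewrite (le_trans (ler_normD _ _))// lerD// normrM.
by apply: is_cvg_seriesD => //; exact: is_cvg_seriesZ.
Qed.

HB.instance Definition _ := GRing.isSubmodClosed.Build R _ l1_pred l1_submod.
HB.instance Definition _ := [SubChoice_isSubLmodule of l1 by <:].

Lemma l1_ext (x y : l1) : (forall n, x n = y n) -> x = y.
Proof. by move=> xy; apply/val_inj/funext. Qed.

Definition l1_norm (x : l1) : R := limn (series (fun n => `|x n|)).

Lemma l1_normD (x y : l1) : l1_norm (x + y) <= l1_norm x + l1_norm y.
Proof.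
rewrite /l1_norm -lim_seriesD; [|exact: l1P..].
apply: lim_series_le; [exact: l1P| |move=> n; exact: ler_normD].
by apply: is_cvg_seriesD; exact: l1P.
Qed.

Lemma l1_normZ (a : R) (x : l1) : l1_norm (a *: x) = `|a| * l1_norm x.
Proof.
rewrite /l1_norm -[RHS]/(`|a| *: _) -lim_seriesZ; last exact: l1P.
by congr (limn (series _)); apply/funext => n; rewrite /= normrM.
Qed.

Lemma l1_norm0 (x : l1) : l1_norm x = 0 -> x = 0.
Proof.
move=> x0; apply: l1_ext => n; apply/eqP; rewrite -normr_le0 -x0.
have nd : nondecreasing_seq (series (fun n => `|x n|)).
  by apply: nondecreasing_series => i _.
have := nondecreasing_cvgn_le nd (@l1P x) n.+1; apply: le_trans.
by rewrite /series/= big_nat_recr//= lerDr sumr_ge0.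
Qed.

HB.instance Definition _ :=
  Lmodule_isNormed.Build R l1 l1_normD l1_normZ l1_norm0.

End l1_def.
Arguments l1 : clear implicits.

Section operations.
Context {R : realType}.
Implicit Types (x y : linf R) (r : l1 R).

Lemma linf_mulP x y : (fun n => x n * y n) \in linf_pred.
Proof.
have [M xM] := linfP x; have [N yN] := linfP y; apply/asboolP.
by exists (M * N) => n; rewrite normrM ler_pM.
Qed.
Definition linf_mul x y : linf R := MkLinf (linf_mulP x y).

Lemma l1_mulP x r : (fun n => x n * r n) \in l1_pred.
Proof.
apply/asboolP; have [M xM] := linfP x.
apply: (@l1_domin _ _ (M *: (fun n => `|r n|))).
  by move=> n; rewrite normrM; exact: ler_wpM2r.
by apply: is_cvg_seriesZ; exact: l1P.
Qed.
Definition l1_mul x r : l1 R := MkL1 (l1_mulP x r).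

Lemma linf_cstP (a : R) : (fun=> a) \in linf_pred.
Proof. by apply/asboolP; exists `|a|. Qed.
Definition linf_one : linf R := MkLinf (linf_cstP 1).

Lemma linf_expP x : (fun n => expR (x n)) \in linf_pred.
Proof.
have [M xM] := linfP x; apply/asboolP; exists (expR M) => n.
by rewrite ger0_norm ?expR_ge0// ler_expR (le_trans (ler_norm _)).
Qed.
Definition linf_exp x : linf R := MkLinf (linf_expP x).

(* The zero sequence if [u] is unbounded. Used below only for the componentwise
   inverse and logarithm, which are bounded when the entries of the argument are
   bounded below by a positive number. *)
Definition linf_of (u : nat -> R) : linf R := insubd (0 : linf R) u.
Definition linf_inv x : linf R := linf_of (fun n => (x n)^-1).
Definition linf_ln x : linf R := linf_of (fun n => ln (x n)).

Lemma linf_shiftP x : (fun n => x n.+1) \in linf_pred.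
Proof. by have [M xM] := linfP x; apply/asboolP; exists M. Qed.
Definition linf_shift x : linf R := MkLinf (linf_shiftP x).

Lemma linf_unshiftP x : (fun n => if n is m.+1 then x m else 0) \in linf_pred.
Proof.
have [M xM] := linfP x; apply/asboolP; exists M => -[|n] //.
by rewrite normr0 (le_trans _ (xM 0%N)).
Qed.
Definition linf_unshift x : linf R := MkLinf (linf_unshiftP x).

Lemma l1_unshiftP r : (fun n => if n is m.+1 then r m else 0) \in l1_pred.
Proof.
apply/asboolP; have /cvg_ex[l rl] := @l1P _ r.
apply/cvg_ex; exists l; rewrite -cvg_shiftS; apply: cvg_trans rl.
apply: near_eq_cvg; near=> n.
by rewrite /series/= big_nat_recl//= normr0 add0r.
Unshelve. all: by end_near. Qed.
Definition l1_unshift r : l1 R := MkL1 (l1_unshiftP r).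

End operations.

Notation "x *oo y" := (linf_mul x y) (at level 40, left associativity).
Notation "x *o1 r" := (l1_mul x r) (at level 40, left associativity).
Notation "s^[ m ]" := (iter m linf_shift) (at level 0, format "s^[ m ]").
Notation "st^[ m ]" := (iter m linf_unshift) (at level 0, format "st^[ m ]").
Notation "st1^[ m ]" := (iter m l1_unshift) (at level 0, format "st1^[ m ]").

Section L0_def.
Context {R : realType} {k : nat}.

Definition L0_pred : {pred linf R} := fun x => s^[k.-1] x == x.

Record L0 := MkL0 { L0_val :> linf R; _ : L0_val \in L0_pred }.

HB.instance Definition _ := [isSub for L0_val].
HB.instance Definition _ := [Choice of L0 by <:].

Lemma iter_shiftE m (x : linf R) n : s^[m] x n = x (n + m)%N.
Proof. by elim: m n => [|m IH] n; rewrite ?addn0//= IH addSnnS. Qed.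

Lemma L0_predP (x : linf R) :
  reflect (forall n, x (n + k.-1)%N = x n) (x \in L0_pred).
Proof.
apply: (iffP eqP) => [xE n|xE]; first by rewrite -iter_shiftE xE.
by apply: linf_ext => n; rewrite iter_shiftE.
Qed.

Lemma L0_submod : submod_closed L0_pred.
Proof.
split; first exact/L0_predP.
move=> a x y /L0_predP xE /L0_predP yE; apply/L0_predP => n.
by change (a * x (n + k.-1)%N + y (n + k.-1)%N = a * x n + y n); rewrite xE yE.
Qed.

HB.instance Definition _ := GRing.isSubmodClosed.Build R _ L0_pred L0_submod.
HB.instance Definition _ := [SubChoice_isSubLmodule of L0 by <:].

Definition L0_norm (x : L0) : R := `|val x|.

Lemma L0_normD (x y : L0) : L0_norm (x + y) <= L0_norm x + L0_norm y.
Proof. exact: ler_normD. Qed.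

Lemma L0_normZ (a : R) (x : L0) : L0_norm (a *: x) = `|a| * L0_norm x.
Proof. exact: normrZ. Qed.

Lemma L0_norm0 (x : L0) : L0_norm x = 0 -> x = 0.
Proof. by move=> /normr0_eq0 x0; exact: val_inj. Qed.

HB.instance Definition _ :=
  Lmodule_isNormed.Build R L0 L0_normD L0_normZ L0_norm0.

Lemma L0_complete (F : set_system L0) : ProperFilter F -> cauchy F -> cvg F.
Proof.
move=> FF /cauchyP Fc.
have /cvg_ex[l Fl] : cvg (L0_val @ F).
  apply: cauchy_cvg; apply/cauchyP => e e0; have [x Fx] := Fc e e0.
  by exists (L0_val x); apply: (@filterS _ F _ (ball x e)).
have Fle (e : R) : 0 < e -> F [set y : L0 | `|l - L0_val y| < e].
  by move=> e0; have /cvgrPdist_lt/(_ e e0) := Fl.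
have lP : l \in L0_pred.
  apply/L0_predP => n; apply/eqP; rewrite -subr_eq0 -normr_le0.
  apply/ler_addgt0Pr => e e0; rewrite add0r.
  have e2 : 0 < e / 2 by rewrite divr_gt0.
  have [y ly] := filter_ex (Fle _ e2).
  have /L0_predP/(_ n) yE := valP y.
  have lyn m : `|l m - L0_val y m| <= e / 2.
    exact: le_trans (linf_norm_ub (l - L0_val y) m) (ltW ly).
  have -> : l (n + k.-1)%N - l n =
      (l (n + k.-1)%N - L0_val y (n + k.-1)%N) - (l n - L0_val y n).
    by rewrite yE opprB addrA subrK.
  by rewrite (le_trans (ler_normB _ _))// [leRHS]splitr lerD.
apply/cvg_ex; exists (MkL0 lP); apply/cvgrPdist_lt => e e0.
exact: Fle.
Qed.

HB.instance Definition _ := Uniform_isComplete.Build L0 L0_complete.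

End L0_def.
Arguments L0 : clear implicits.

(* [is_Cn n U f] for all [n] is Frechet smoothness of [f] on the open set [U]:
   a map is smooth iff it is Frechet differentiable and its tangent map
   [(x, v) |-> df(x) v] is smooth. *)
Fixpoint is_Cn {R : realType} (n : nat) (E F : normedModType R) (U : set E)
    (f : E -> F) : Prop :=
  match n with
  | 0 => forall x, U x -> {for x, continuous f}
  | n'.+1 => (forall x, U x -> differentiable f x) /\
      @is_Cn R n' (E * E)%type F (U `*` setT) (fun xv => 'd f (xv.1) (xv.2))
  end.

Definition smooth_on {R : realType} (E F : normedModType R) (U : set E)
  (f : E -> F) : Prop := forall n, is_Cn n U f.

Record chart (T E : Type) := Chart {
  cdom : set T; cmap :> T -> E; cinv : E -> T }.

Record manifold (R : realType) := Manifold {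
  mpoint : Type;
  mcarrier : set mpoint;
  mmodel : completeNormedModType R;
  matlas : set (chart mpoint mmodel) }.

Definition chart_at {R : realType} (M : manifold R) (x : mpoint M) :
  set (chart (mpoint M) (mmodel M)) := [set c | matlas c /\ cdom c x].
Arguments chart_at {R} M x.

Definition is_banach_manifold {R : realType} (M : manifold R) : Prop :=
  [/\ forall c, @matlas R M c ->
        [/\ cdom c `<=` @mcarrier R M, open (c @` cdom c) &
            forall x, cdom c x -> cinv c (c x) = x],
      forall x, @mcarrier R M x -> chart_at M x !=set0,
      forall c d, @matlas R M c -> matlas d ->
        open (c @` (cdom c `&` cdom d)) /\
        smooth_on (c @` (cdom c `&` cdom d)) (d \o cinv c) &
      forall x y, @mcarrier R M x -> @mcarrier R M y -> x <> y ->
        exists c d, exists A B : set (mmodel M),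
          [/\ chart_at M x c, chart_at M y d,
              open A /\ A (c x), open B /\ B (d y) &
              (cdom c `&` c @^-1` A) `&` (cdom d `&` d @^-1` B) = set0] ].

Definition smooth_map {R : realType} (M N : manifold R)
    (f : mpoint M -> mpoint N) : Prop :=
  set_fun (@mcarrier R M) (@mcarrier R N) f /\
  forall c d, @matlas R M c -> @matlas R N d ->
    let U := c @` (cdom c `&` f @^-1` cdom d) in
    open U /\ smooth_on U (d \o f \o cinv c).

Definition prod_chart {T T' E E' : Type} (c : chart T E) (d : chart T' E') :
  chart (T * T') (E * E') :=
  Chart (cdom c `*` cdom d) (fun x => (c x.1, d x.2))
    (fun u => (cinv c u.1, cinv d u.2)).

Definition prod_manifold {R : realType} (M N : manifold R) : manifold R :=
  @Manifold R (mpoint M * mpoint N)%type (@mcarrier R M `*` @mcarrier R N)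
    (mmodel M * mmodel N)%type
    [set e | exists c d, [/\ matlas c, matlas d & e = prod_chart c d]].

Record lie_group (R : realType) := LieGroup {
  lmanifold :> manifold R;
  lmul : mpoint lmanifold -> mpoint lmanifold -> mpoint lmanifold;
  lone : mpoint lmanifold;
  linv : mpoint lmanifold -> mpoint lmanifold }.
Arguments lmul {R} G : rename.
Arguments lone {R} G : rename.
Arguments linv {R} G : rename.

Definition is_banach_lie_group {R : realType} (G : lie_group R) : Prop :=
  [/\ is_banach_manifold G,
      @mcarrier R G (lone G),
      [/\ {in @mcarrier R G & &, associative (lmul G)},
          {in @mcarrier R G, left_id (lone G) (lmul G)} &
          {in @mcarrier R G, right_id (lone G) (lmul G)} ],
      {in @mcarrier R G, forall x,
        lmul G (linv G x) x = lone G /\ lmul G x (linv G x) = lone G} &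
      @smooth_map R (prod_manifold G G) G (fun x => lmul G x.1 x.2) /\
      @smooth_map R G G (linv G)].

Definition is_lie_hom {R : realType} (G H : lie_group R)
    (f : mpoint G -> mpoint H) : Prop :=
  smooth_map f /\
  {in @mcarrier R G &, forall x y, f (lmul G x y) = lmul H (f x) (f y)}.

(* The differential of [f] at [x] read in the charts [c] and [d]. *)
Definition chart_diff {R : realType} (M N : manifold R)
    (f : mpoint M -> mpoint N) (c : chart (mpoint M) (mmodel M))
    (d : chart (mpoint N) (mmodel N)) (x : mpoint M) : mmodel M -> mmodel N :=
  'd (d \o f \o cinv c) (c x).

(* Split injectivity: existence of a continuous linear left inverse of the
   differential, i.e. it is injective with closed complemented range. *)
Definition immersion_at {R : realType} (M N : manifold R)
    (f : mpoint M -> mpoint N) (x : mpoint M) : Prop :=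
  forall c d, chart_at M x c -> chart_at N (f x) d ->
  exists l : {linear mmodel N -> mmodel M},
    continuous l /\ cancel (chart_diff f c d x) l.

(* Existence of a continuous linear right inverse of the differential, i.e. it
   is surjective with complemented kernel. *)
Definition submersion_at {R : realType} (M N : manifold R)
    (f : mpoint M -> mpoint N) (x : mpoint M) : Prop :=
  forall c d, chart_at M x c -> chart_at N (f x) d ->
  exists r : {linear mmodel N -> mmodel M},
    continuous r /\ cancel r (chart_diff f c d x).

(* 1 -> N -i-> G -p-> Q -> 1 is exact, both as a sequence of groups and on
   tangent spaces; the differentials split, so that N is a split Lie subgroup
   of G and the manifold structure of Q is the quotient one. *)
Definition exact_lie_sequence {R : realType} (N G Q : lie_group R)
    (i : mpoint N -> mpoint G) (p : mpoint G -> mpoint Q) : Prop :=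
  [/\ [/\ is_banach_lie_group N, is_banach_lie_group G & is_banach_lie_group Q],
      is_lie_hom i /\ is_lie_hom p,
      [/\ {in @mcarrier R N &, injective i},
          i @` @mcarrier R N = @mcarrier R G `&` p @^-1` [set lone Q] &
          p @` @mcarrier R G = @mcarrier R Q],
      (forall x, @mcarrier R N x -> immersion_at i x) /\
      (forall x, @mcarrier R G x -> submersion_at p x) &
      forall x, @mcarrier R N x -> forall c d e, chart_at N x c ->
        chart_at G (i x) d -> chart_at Q (p (i x)) e ->
        range (chart_diff i c d x) =
          [set v | chart_diff p d e (i x) v = 0] ].

(* A tangent vector at a point of [M], given by its coordinates in the charts at
   that point (and 0 for the other charts). *)
Definition tangent {R : realType} (M : manifold R) : Type :=
  chart (mpoint M) (mmodel M) -> mmodel M.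

(* The tangent map at [x], applied to [v], of a map from an open subset of a
   normed space to [M]. *)
Definition tangent_map {R : realType} (E : normedModType R) (M : manifold R)
    (f : E -> mpoint M) (x v : E) : tangent M :=
  fun c => if `[< chart_at M (f x) c >] then 'd (c \o f) x v else 0.

Section operators.
Context {R : realType}.

(* An operator is given by its matrix A i j = <i|A|j> in the basis |n>. *)
Definition operator := nat -> nat -> R.

Definition op_add (A B : operator) : operator := fun i j => A i j + B i j.
Definition op_mul (A B : operator) : operator :=
  fun i j => limn (series (fun l => A i l * B l j)).
Definition op_one : operator := fun i j => (i == j)%:R.
Definition op_exp (A : operator) m : operator := iter m (op_mul A) op_one.
Definition op_tr (A : operator) : operator := fun i j => A j i.
Definition op_diag (x : nat -> R) : operator := fun i j => x i *+ (i == j).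
Definition op_S : operator := fun i j => (j == i.+1)%:R.
Definition trace (A : operator) : R := limn (series (fun n => A n n)).

End operators.
Arguments operator : clear implicits.

Section groups.
Context {R : realType}.
Variable k : nat.

(* The pair (x_0, x_{k-1}) stands for the operator x_0 + x_{k-1} S^{k-1}, and the
   pair (rho_0, rho_{k-1}) for rho_0 + (S^T)^{k-1} rho_{k-1}. *)
Definition Ip_op (x : linf R * linf R) : operator R :=
  op_add (op_diag x.1) (op_mul (op_diag x.2) (op_exp op_S k.-1)).
Definition Im_op (rho : l1 R * l1 R) : operator R :=
  op_add (op_diag rho.1) (op_mul (op_exp (op_tr op_S) k.-1) (op_diag rho.2)).

Definition GI : set (linf R * linf R) :=
  [set g : linf R * linf R | exists2 e : R, 0 < e & forall n, e <= g.1 n].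

Definition kmul (g h : linf R * linf R) : linf R * linf R :=
  (g.1 *oo h.1, g.1 *oo h.2 + g.2 *oo s^[k.-1] h.1).
Definition kone : linf R * linf R := (linf_one, 0).
Definition kinv (g : linf R * linf R) : linf R * linf R :=
  (linf_inv g.1, - (linf_inv g.1 *oo g.2 *oo s^[k.-1] (linf_inv g.1))).

Definition kbracket (x y : linf R * linf R) : linf R * linf R :=
  (0, x.2 *oo (s^[k.-1] y.1 - y.1) - y.2 *oo (s^[k.-1] x.1 - x.1)).

Definition GL0 : set (linf R * linf R) :=
  [set g : linf R * linf R | [/\ GI g, g.2 = 0 & s^[k.-1] g.1 = g.1]].

Definition L0set : set (linf R) := [set x | s^[k.-1] x = x].

(* GI is open in its Lie algebra, and GL0 is open in L0. *)
Definition GI_lie : lie_group R :=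
  @LieGroup R
    (@Manifold R _ GI (linf R * linf R)%type [set Chart GI id id])
    kmul kone kinv.

Definition GL0_lie : lie_group R :=
  @LieGroup R
    (@Manifold R _ GL0 (L0 R k)
      [set Chart GL0 (fun g => insubd (0 : L0 R k) g.1)
             (fun x => (L0_val x, 0))])
    kmul kone kinv.

Definition kcoset (g : linf R * linf R) : set (linf R * linf R) :=
  [set kmul g h | h in GL0].

Definition periodic_part (x : linf R) : linf R :=
  linf_of (fun n => x (n %% k.-1)%N).

(* The periodic sequences L0 have in linf the complement of the sequences whose
   first k - 1 entries vanish, and s^{k-1} maps this complement isomorphically
   onto linf. Since GL0 acts on [(ln g_0, g_0^-1 g_{k-1})] by translations of the
   first component by L0, this gives a global chart of GI / GL0. *)
Definition coset_chart : chart (set (linf R * linf R)) (linf R * linf R) :=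
  Chart (kcoset @` GI)
    (fun C => let g := get C in
      (s^[k.-1] (linf_ln g.1 - periodic_part (linf_ln g.1)), linf_inv g.1 *oo g.2))
    (fun u => let g0 := linf_exp (st^[k.-1] u.1) in kcoset (g0, g0 *oo u.2)).

Definition GQ_lie : lie_group R :=
  @LieGroup R
    (@Manifold R _ (kcoset @` GI) (linf R * linf R)%type [set coset_chart])
    (fun C D => [set kmul g h | g in C & h in D])
    GL0
    (fun C => kinv @` C).

(* This is (Ad^{+,k})^*_{g^{-1}} rho. *)
Definition coAd (g : linf R * linf R) (rho : l1 R * l1 R) : l1 R * l1 R :=
  let a := (linf_inv g.1 *oo g.2) *o1 rho.2 in
  (rho.1 + a - st1^[k.-1] a, (s^[k.-1] g.1 *oo linf_inv g.1) *o1 rho.2).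

Definition deltak (rho : l1 R * l1 R) : l1 R * l1 R := (0, rho.2).

End groups.

Section maps.
Context {R : realType}.
Variables (k : nat) (nu : l1 R).

Definition Delta : set (l1 R * l1 R) :=
  [set (0, (s^[k.-1] g.1 *oo linf_inv g.1) *o1 nu) | g in GI `&` [set g | g.2 = 0]].

Definition Phi_nu (g : linf R * linf R) : linf R * l1 R :=
  let a := (g.2 *oo linf_inv g.1) *o1 nu in (linf_ln g.1, a - st1^[k.-1] a).

Definition J_nu (qp : linf R * l1 R) : l1 R * l1 R :=
  (qp.2, linf_exp (s^[k.-1] qp.1 - qp.1) *o1 nu).

(* The value does not depend on the representative [get C] of the coset. *)
Definition iota_nu (C : set (linf R * linf R)) : l1 R * l1 R :=
  coAd k (get C) (0, nu).

(* The value of the form at any point, the tangent spaces all being linf * l1. *)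
Definition omega (u v : linf R * l1 R) : R :=
  limn (series (fun i => u.1 i * v.2 i - v.1 i * u.2 i)).

Definition tangent_coset (g X : linf R * linf R) : tangent (@GQ_lie R k) :=
  @tangent_map R _ (GQ_lie k) (kcoset k) g X.

(* The value at [C] on tangent vectors [U], [V] at [C], i.e. the common value of
   the right-hand side over all g, x, y representing C, U, V. *)
Definition omega_nu (C : set (linf R * linf R)) (U V : tangent (@GQ_lie R k)) :
    R :=
  get [set t | exists g x y, [/\ GI g, kcoset k g = C,
    tangent_coset g (kmul k g x) = U, tangent_coset g (kmul k g y) = V &
    t = trace (op_mul (Im_op k (0, nu)) (Ip_op k (kbracket k x y)))]].

End maps.
Arguments tangent_coset {R} k g X.
Arguments omega_nu {R} k nu C U V.
Arguments GI_lie {R} k.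
Arguments GL0_lie {R} k.
Arguments GQ_lie {R} k.

(* Main.v *)
From HB Require Import structures.
Require Import Defs.
From mathcomp Require Import all_boot all_order all_algebra.
From mathcomp Require Import all_classical all_reals all_analysis.
From mathcomp Require Import lra ring.

Import Order.TTheory GRing.Theory Num.Theory.
Import numFieldNormedType.Exports.

Local Open Scope classical_set_scope.
Local Open Scope ring_scope.

Set Implicit Arguments.
Unset Strict Implicit.

(* [GL0] acts on [(ln g_0, g_0^-1 g_{k-1})] by translation of the first component
   by the periodic sequences, hence
   [g |-> (s^{k-1} (ln g_0 - periodic part), g_0^-1 g_{k-1})] induces a global
   chart of the quotient whose inverse is induced by [coset_lift]. All maps of the
   first row are composites, in global charts, of bounded linear and bilinear maps
   with the componentwise exponential, logarithm and inverse; the latter are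
   smooth because they are differentiable with uniform quadratic remainder and
   their differentials are again such composites.

   In the chart, [omega_nu] has constant coefficients: if [u] and [v] are the
   coordinates of the images of [X] and [Y], then [d Phi X] is
   [(q, a - st^{k-1} a)] with [a = u_1 nu] and
   [q - s^{k-1} q = st^{k-1} u_0 - u_0], so summation by parts turns
   [omega (d Phi X) (d Phi Y)] into an expression in [u] and [v] only, which for
   [X = g o x] and [Y = g o y] is the trace. *)

(** * Frechet calculus *)

Section frechet.
Context {R : realType}.
Implicit Types E F G H : normedModType R.

(** A predicate on bare functions, so that explicit expressions are handled by closure rules and
    bundled only where a differential is required. *)
Definition bounded_linear E F (f : E -> F) : Prop :=
  linear f /\ exists M, forall x, `|f x| <= M * `|x|.

Lemma bounded_linear_pack E F (f : E -> F) : bounded_linear f ->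
  exists2 L : {linear E -> F}, f = L & continuous L.
Proof.
move=> [lf [M fM]].
pose mix := GRing.isLinear.Build _ _ _ _ _ lf.
pose L : {linear E -> F} := HB.pack f mix.
exists L => //; apply: bounded_linear_continuous; apply/linear_boundedP.
exists (Num.max M 0); split; first exact: num_real.
move=> r Mr x; rewrite (le_trans (fM x))// ler_wpM2r//.
by rewrite (le_trans _ (ltW Mr))// le_max lexx.
Qed.

(** A remainder [C |h|^2] is at most [e |h|] once [|h| <= e / max(C, 1)], so it is little-o and
    uniqueness of the differential concludes. The basic differentials below all come from this
    criterion. *)
Lemma is_diff_quadratic E F (f L : E -> F) (x : E) (C : R) :
  bounded_linear L ->
  (\forall h \near (0 : E), `|f (h + x) - f x - L h| <= C * `|h| ^+ 2) ->
  is_diff x f L.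
Proof.
move=> /bounded_linear_pack[df -> dfc] rem.
have fE : f \o shift x = cst (f x) + df +o_ (0 : E) id.
  (* [C] may be zero or negative, whereas [Num.max C 1] can be divided by. *)
  have C1 : 0 < Num.max C 1 by rewrite lt_max ltr01 orbT.
  apply/eqaddoP => _/posnumP[e]; near=> h.
  have -> : (f \o shift x - (cst (f x) + df)) h = f (h + x) - f x - df h.
    by rewrite opprD addrA.
  apply: (@le_trans _ _ (C * `|h| ^+ 2)); first by near: h.
  apply: (@le_trans _ _ (Num.max C 1 * `|h| ^+ 2)).
    by rewrite ler_wpM2r ?exprn_ge0// le_max lexx.
  rewrite expr2 mulrA ler_wpM2r// -ler_pdivlMl//.
  near: h; apply/nbhs_norm0P; exists ((Num.max C 1)^-1 * e%:num) => /=.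
    by rewrite mulr_gt0// invr_gt0.
  by move=> y /= /ltW.
have dE := diff_unique dfc fE.
by apply: DiffDef => //; apply/diff_locallyP; rewrite dE.
Unshelve. all: by end_near. Qed.

(** Both maps have the same first-order expansion at [x]. Needed because chart expressions agree
    with explicit formulas only on an open set. *)
Lemma is_diff_near E F (f g df : E -> F) (x : E) :
  (\forall y \near x, f y = g y) -> is_diff x f df -> is_diff x g df.
Proof.
move=> fg [dfx dfE].
have fgx : f x = g x by apply: nbhs_singleton fg.
have gE : g \o shift x = cst (g x) + 'd f x +o_ (0 : E) id.
  have := diff_locally dfx => /eqaddoP fo; apply/eqaddoP => e e0.
  have fg0 : \forall h \near (0 : E), f (h + x) = g (h + x).
    by move: fg; rewrite (near_shift 0) => fg; apply: filterS fg => h /=; rewrite subr0.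
  move: (fo e e0) => feo; near=> h.
  have -> : (g \o shift x - (cst (g x) + 'd f x)) h =
            (f \o shift x - (cst (f x) + 'd f x)) h.
    have fgh : f (h + x) = g (h + x) by near: h.
    change (g (h + x) - (g x + 'd f x h) = f (h + x) - (f x + 'd f x h)).
    by rewrite fgh fgx.
  by near: h.
have dE := diff_unique (diff_continuous dfx) gE.
apply: DiffDef; last by rewrite dE.
apply/diff_locallyP; rewrite dE; split => //; exact: diff_continuous.
Unshelve. all: by end_near. Qed.

Lemma is_diff_bounded_linear E F (f : E -> F) (x : E) :
  bounded_linear f -> is_diff x f f.
Proof.
move=> lf; apply: (@is_diff_quadratic _ _ _ _ _ 0) => //.
near=> h; rewrite mul0r normr_le0; apply/eqP.
by have [lin _] := lf; have := lin 1 h x; rewrite !scale1r => ->; rewrite addrK subrr.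
Unshelve. all: by end_near. Qed.

Definition bounded_bilinear E F G (b : E -> F -> G) : Prop :=
  [/\ forall x, linear (b x), forall y, linear (b^~ y) &
      exists2 M, 0 <= M & forall x y, `|b x y| <= M * `|x| * `|y|].

Lemma le_norm_fst E F (x : E * F) : `|x.1| <= `|x|.
Proof. by rewrite prod_normE/= le_max lexx. Qed.

Lemma le_norm_snd E F (x : E * F) : `|x.2| <= `|x|.
Proof. by rewrite prod_normE/= le_max lexx orbT. Qed.

Lemma bounded_linear_fst E F : bounded_linear (@fst E F).
Proof. by split => //; exists 1 => x; rewrite mul1r le_norm_fst. Qed.

Lemma bounded_linear_snd E F : bounded_linear (@snd E F).
Proof. by split => //; exists 1 => x; rewrite mul1r le_norm_snd. Qed.

Lemma bounded_linear_id E : bounded_linear (@id E).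
Proof. by split => //; exists 1 => x; rewrite mul1r. Qed.

Lemma bounded_linear_ge0 E F (f : E -> F) : bounded_linear f ->
  exists2 M, 0 <= M & forall x, `|f x| <= M * `|x|.
Proof.
move=> [_ [M fM]]; exists (Num.max M 0) => [|x]; first by rewrite le_max lexx orbT.
by rewrite (le_trans (fM x))// ler_wpM2r// le_max lexx.
Qed.

Lemma bounded_linear_comp E F G (g : F -> G) (f : E -> F) :
  bounded_linear g -> bounded_linear f -> bounded_linear (fun x => g (f x)).
Proof.
move=> gl fl; split.
  by move=> a u v; rewrite fl.1 gl.1.
have [M M0 gM] := bounded_linear_ge0 gl; have [N _ fN] := bounded_linear_ge0 fl.
by exists (M * N) => x; rewrite (le_trans (gM _))// -mulrA ler_wpM2l.
Qed.

Lemma bounded_linearD E F (f g : E -> F) :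
  bounded_linear f -> bounded_linear g -> bounded_linear (fun x => f x + g x).
Proof.
move=> fl gl; split.
  by move=> a u v; rewrite fl.1 gl.1 scalerDr addrACA.
have [M M0 fM] := bounded_linear_ge0 fl; have [N _ gN] := bounded_linear_ge0 gl.
by exists (M + N) => x; rewrite (le_trans (ler_normD _ _))// mulrDl lerD.
Qed.

Lemma bounded_linearN E F (f : E -> F) :
  bounded_linear f -> bounded_linear (fun x => - f x).
Proof.
move=> fl; split; first by move=> a u v; rewrite fl.1 opprD scalerN.
by have [M M0 fM] := bounded_linear_ge0 fl; exists M => x; rewrite normrN.
Qed.

Lemma bounded_linear_pair E F G (f : E -> F) (g : E -> G) :
  bounded_linear f -> bounded_linear g -> bounded_linear (fun x => (f x, g x)).
Proof.
move=> fl gl; split; first by move=> a u v; rewrite fl.1 gl.1.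
have [M M0 fM] := bounded_linear_ge0 fl; have [N N0 gN] := bounded_linear_ge0 gl.
exists (M + N) => x; rewrite prod_normE/= ge_max mulrDl.
by rewrite (le_trans (fM x)) ?lerDl ?mulr_ge0//= (le_trans (gN x))// lerDr mulr_ge0.
Qed.

Lemma bounded_bilinearl E F G (b : E -> F -> G) x :
  bounded_bilinear b -> bounded_linear (b x).
Proof.
by move=> [l1 l2 [M M0 bM]]; split => //; exists (M * `|x|) => y; exact: bM.
Qed.

Lemma bounded_bilinearr E F G (b : E -> F -> G) y :
  bounded_bilinear b -> bounded_linear (b^~ y).
Proof.
move=> [l1 l2 [M M0 bM]]; split => //; exists (M * `|y|) => x.
by rewrite mulrAC; exact: bM.
Qed.

(** The remainder is exactly [b h.1 h.2], of size at most [M |h|^2]. *)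
Lemma is_diff_bilinear E F G (b : E -> F -> G) (p : E * F) :
  bounded_bilinear b ->
  is_diff p (fun q => b q.1 q.2) (fun q => b p.1 q.2 + b q.1 p.2).
Proof.
move=> bb; have [l1 l2 [M M0 bM]] := bb; apply: (@is_diff_quadratic _ _ _ _ _ M).
  apply: bounded_linearD.
    exact: bounded_linear_comp (bounded_bilinearl _ bb) (@bounded_linear_snd _ _).
  exact: bounded_linear_comp (bounded_bilinearr _ bb) (@bounded_linear_fst _ _).
near=> h.
have addl x x' y : b (x + x') y = b x y + b x' y.
  by have := l2 y 1 x x'; rewrite !scale1r.
have addr x y y' : b x (y + y') = b x y + b x y'.
  by have := l1 x 1 y y'; rewrite !scale1r.
have -> : b (h + p).1 (h + p).2 - b p.1 p.2 - (b p.1 h.2 + b h.1 p.2) = b h.1 h.2.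
  by rewrite /= addl !addr addrA addrK opprD addrA addrK addrK.
rewrite (le_trans (bM _ _))// expr2 mulrA ler_pM ?mulr_ge0//.
  by rewrite ler_wpM2l// le_norm_fst.
exact: le_norm_snd.
Unshelve. all: by end_near. Qed.

Lemma is_diff_compose E F G (f df : E -> F) (g dg : F -> G) (x : E) :
  is_diff x f df -> is_diff (f x) g dg ->
  is_diff x (fun y => g (f y)) (fun v => dg (df v)).
Proof. by move=> fx gx; apply: is_diff_comp. Qed.

Lemma open_setX (T T' : topologicalType) (A : set T) (B : set T') :
  open A -> open B -> open (A `*` B).
Proof.
move=> oA oB; rewrite openE => -[a b] [/= Aa Bb]; exists (A, B) => //=.
by split; exact: open_nbhs_nbhs.
Qed.

(** Maps that agree on an open set have the same differential at its points, hence tangent maps that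
    agree over it; induction on the order follows. *)
Lemma is_Cn_ext n E F (U : set E) (f g : E -> F) : open U ->
  {in U, f =1 g} -> is_Cn n U f -> is_Cn n U g.
Proof.
elim: n E F U f g => [|n IH] E F U f g oU fg.
  move=> fc x Ux /=; have := fc x Ux; rewrite /prop_for/continuous_at.
  rewrite -(fg x (mem_set Ux)) => fx; apply: cvg_trans fx; apply: near_eq_cvg.
  apply: filterS (open_nbhs_nbhs (conj oU Ux)) => y Uy.
  by rewrite fg// inE.
have dg x : U x -> is_diff x f ('d f x) -> is_diff x g ('d f x).
  move=> Ux; apply: is_diff_near.
  by apply: filterS (open_nbhs_nbhs (conj oU Ux)) => y Uy; rewrite fg// inE.
move=> [fd dfn]; split=> [x Ux|].
  by have [] := dg x Ux (differentiableP (fd x Ux)).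
apply: IH dfn; first by apply: open_setX => //; exact: openT.
move=> xv; rewrite inE => -[Ux _].
by have [_ ->] := dg xv.1 Ux (differentiableP (fd _ Ux)).
Qed.

(** Replaces the abstract differential by an explicit formula [df], on which inductions on the order
    can act. *)
Lemma is_CnS n E F (U : set E) (f : E -> F) (df : E -> E -> F) : open U ->
  (forall x, U x -> is_diff x f (df x)) ->
  is_Cn n (U `*` setT) (fun xv => df xv.1 xv.2) -> is_Cn n.+1 U f.
Proof.
move=> oU fd dfn; split=> [x /fd[]//|].
apply: is_Cn_ext dfn; first by apply: open_setX => //; exact: openT.
by move=> xv; rewrite inE => -[/fd[_ ->] _].
Qed.

Lemma is_CnW n E F (U : set E) (f : E -> F) : is_Cn n.+1 U f -> is_Cn n U f.
Proof.
elim: n E F U f => [|n IH] E F U f.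
  by move=> [fd _] x Ux; apply: differentiable_continuous; exact: fd.
by move=> [fd dfn]; split => //; exact: IH.
Qed.

Lemma is_Cn_bounded_linear n E F (U : set E) (f : E -> F) :
  open U -> bounded_linear f -> is_Cn n U f.
Proof.
elim: n E F U f => [|n IH] E F U f oU fl.
  by have [L -> Lc] := bounded_linear_pack fl => x _; exact: Lc.
apply: (@is_CnS _ _ _ _ _ (fun=> f)) => // [x _|].
  exact: is_diff_bounded_linear.
apply: IH; first by apply: open_setX => //; exact: openT.
exact: bounded_linear_comp (@bounded_linear_snd _ _).
Qed.

Lemma is_Cn_pair n E F G (U : set E) (f : E -> F) (g : E -> G) : open U ->
  is_Cn n U f -> is_Cn n U g -> is_Cn n U (fun x => (f x, g x)).
Proof.
elim: n E F G U f g => [|n IH] E F G U f g oU.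
  by move=> fc gc x Ux; apply: cvg_pair; [exact: fc|exact: gc].
move=> [fd dfn] [gd dgn].
apply: (@is_CnS _ _ _ _ _ (fun x v => ('d f x v, 'd g x v))) => // [x Ux|].
  by apply: is_diff_pair; apply: differentiableP; [exact: fd|exact: gd].
by apply: IH => //; apply: open_setX => //; exact: openT.
Qed.

(** The tangent map of a composite is the composite of the tangent maps, to which the induction
    hypothesis applies. *)
Lemma is_Cn_comp n E F G (U : set E) (V : set F) (f : E -> F) (g : F -> G) :
  open U -> open V -> (forall x, U x -> V (f x)) ->
  is_Cn n U f -> is_Cn n V g -> is_Cn n U (fun x => g (f x)).
Proof.
elim: n E F G U V f g => [|n IH] E F G U V f g oU oV fUV.
  move=> fc gc x Ux; apply: continuous_comp; first exact: fc.
  by apply: gc; exact: fUV.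
move=> fn1 gn1; have [fd dfn] := fn1; have [gd dgn] := gn1.
apply: (@is_CnS _ _ _ _ _ (fun x v => 'd g (f x) ('d f x v))) => // [x Ux|].
  apply: is_diff_compose; apply: differentiableP; first exact: fd.
  by apply: gd; exact: fUV.
have oUT : open (U `*` [set: E]) by apply: open_setX => //; exact: openT.
apply: (@IH (E * E)%type (F * F)%type G _ (V `*` [set: F])
  (fun xv => (f xv.1, 'd f (xv.1) xv.2)) (fun yw => 'd g (yw.1) yw.2)) => //.
- by apply: open_setX => //; exact: openT.
- by move=> xv [Ux _]; split => //; exact: fUV.
- apply: is_Cn_pair => //.
  apply: (@IH _ _ _ _ U fst f) => //; [by move=> xv []| |exact: is_CnW].
  exact/is_Cn_bounded_linear/bounded_linear_fst.
Qed.

Lemma is_Cn_linear n E F G (U : set E) (f : E -> F) (L : F -> G) :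
  open U -> bounded_linear L -> is_Cn n U f -> is_Cn n U (fun x => L (f x)).
Proof.
move=> oU Ll fn; apply: (@is_Cn_comp _ _ _ _ _ setT) => //; first exact: openT.
by apply: is_Cn_bounded_linear => //; exact: openT.
Qed.

Lemma is_CnD n E F (U : set E) (f g : E -> F) : open U ->
  is_Cn n U f -> is_Cn n U g -> is_Cn n U (fun x => f x + g x).
Proof.
move=> oU fn gn.
apply: (@is_Cn_linear _ _ _ _ U (fun x => (f x, g x)) (fun y => y.1 + y.2)) => //.
  by apply: bounded_linearD; [exact: bounded_linear_fst|exact: bounded_linear_snd].
exact: is_Cn_pair.
Qed.

Lemma is_CnN n E F (U : set E) (f : E -> F) : open U ->
  is_Cn n U f -> is_Cn n U (fun x => - f x).
Proof.
by move=> oU fn; apply: (is_Cn_linear oU (bounded_linearN (@bounded_linear_id _)) fn).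
Qed.

(** The differential of [q |-> b q.1 q.2] is a sum of two copies of this map precomposed with
    bounded linear projections, so the induction closes on [b] alone; the general case is a
    composition. *)
Lemma is_Cn_bilinear n E F G H (b : F -> G -> H) (U : set E) (f : E -> F)
    (g : E -> G) : open U -> bounded_bilinear b ->
  is_Cn n U f -> is_Cn n U g -> is_Cn n U (fun x => b (f x) (g x)).
Proof.
move=> oU bb fn gn.
have bn : is_Cn n setT (fun q => b q.1 q.2).
  elim: n {E U oU f g fn gn} => [|n IH].
    move=> q _; apply: differentiable_continuous.
    by have [] := is_diff_bilinear q bb.
  apply: (@is_CnS _ _ _ _ _ (fun q r => b q.1 r.2 + b r.1 q.2)).
  - exact: openT.
  - by move=> q _; exact: is_diff_bilinear.
  have oT : open (@setT (F * G)%type `*` @setT (F * G)%type).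
    by rewrite setXTT; exact: openT.
  apply: is_CnD => //.
    apply: (@is_Cn_comp _ _ _ _ _ setT (fun qr => (qr.1.1, qr.2.2))
      (fun q => b q.1 q.2) oT openT) => //.
    apply: is_Cn_bounded_linear => //.
    by split => //; exists 1 => x; rewrite mul1r !prod_normE/= ge_max !le_max !lexx ?orbT.
  apply: (@is_Cn_comp _ _ _ _ _ setT (fun qr => (qr.2.1, qr.1.2))
    (fun q => b q.1 q.2) oT openT) => //.
  apply: is_Cn_bounded_linear => //.
  by split => //; exists 1 => x; rewrite mul1r !prod_normE/= ge_max !le_max !lexx ?orbT.
apply: (@is_Cn_comp _ _ _ _ _ setT (fun x => (f x, g x)) (fun q => b q.1 q.2)) => //.
  exact: openT.
exact: is_Cn_pair.
Qed.

End frechet.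

(** * Componentwise operations on bounded sequences *)

Section scalar.
Context {R : realType}.
Implicit Types h t x : R.

Lemma expR_le_inv1B h : h < 1 -> expR h <= (1 - h)^-1.
Proof.
move=> h1; rewrite -[expR h]invrK -expRN lef_pV2 ?posrE ?expR_gt0 ?subr_gt0//.
by rewrite expR_ge1Dx.
Qed.

(** [expR h] lies between [1 + h] and [(1 - h)^-1], so the remainder is at most [h^2 / (1 - h)],
    where [1 - h >= 1/2]. *)
Lemma expR_remainder h : `|h| <= 2^-1 -> `|expR h - 1 - h| <= 2 * h ^+ 2.
Proof.
rewrite ler_norml => /andP[h1 h2]; have hlo := expR_ge1Dx h.
have hhi : expR h <= (1 - h)^-1 by apply: expR_le_inv1B; lra.
rewrite ger0_norm; last lra.
apply: (@le_trans _ _ ((1 - h)^-1 - 1 - h)); first lra.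
have -> : (1 - h)^-1 - 1 - h = (1 - h)^-1 * h ^+ 2 by field; lra.
rewrite ler_wpM2r ?sqr_ge0// -[leRHS]invrK lef_pV2 ?posrE; lra.
Qed.

(** After exponentiation the lower bound reduces to [(1 + t) (1 - t + 2 t^2) = 1 + t^2 (1 + 2 t) >=
    1]. *)
Lemma ln1D_remainder t : `|t| <= 2^-1 -> `|ln (1 + t) - t| <= 2 * t ^+ 2.
Proof.
rewrite ler_norml => /andP[h1 h2].
have t1 : 0 < 1 + t by lra.
have hi : ln (1 + t) <= t by rewrite -ler_expR lnK ?posrE// expR_ge1Dx.
rewrite ler0_norm; last lra.
suff : t - 2 * t ^+ 2 <= ln (1 + t) by lra.
rewrite -ler_expR lnK ?posrE//; apply: (le_trans (expR_le_inv1B _)); first nra.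
have d0 : 0 < 1 - (t - 2 * t ^+ 2) by nra.
rewrite -[leLHS]mul1r ler_pdivrMr//; nra.
Qed.

End scalar.

(** * Shifts, products, exponential, logarithm and inverse of sequences *)

Section sequences.
Context {R : realType}.
Implicit Types (x y z h : linf R) (r : l1 R).

Lemma linfDE x y n : (x + y) n = x n + y n. Proof. by []. Qed.
Lemma linfNE x n : (- x) n = - x n. Proof. by []. Qed.
Lemma linfBE x y n : (x - y) n = x n - y n. Proof. by []. Qed.
Lemma linfZE a x n : (a *: x) n = a * x n. Proof. by []. Qed.
Lemma linf_mulE x y n : (x *oo y) n = x n * y n. Proof. by []. Qed.
Lemma linf_expE x n : linf_exp x n = expR (x n). Proof. by []. Qed.
Lemma l1_mulE x r n : (x *o1 r) n = x n * r n. Proof. by []. Qed.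
Lemma l1BE (r r' : l1 R) n : (r - r') n = r n - r' n. Proof. by []. Qed.

Lemma le_linf_norm x n : `|x n| <= `|x|.
Proof. exact: linf_norm_ub. Qed.

Lemma linf_ofE (u : nat -> R) n : u \in linf_pred -> linf_of u n = u n.
Proof. by move=> ul; rewrite /linf_of /insubd insubT. Qed.

Lemma iter_unshiftE m x n :
  st^[m] x n = if (n < m)%N then 0 else x (n - m)%N.
Proof.
elim: m n => [|m IH] n; first by rewrite subn0.
by case: n => [|n] //=; rewrite IH.
Qed.

Lemma iter_unshift1E m r n :
  st1^[m] r n = if (n < m)%N then 0 else r (n - m)%N.
Proof.
elim: m n => [|m IH] n; first by rewrite subn0.
by case: n => [|n] //=; rewrite IH.
Qed.

Lemma shift_unshift m x : s^[m] (st^[m] x) = x.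
Proof.
apply: linf_ext => n; rewrite iter_shiftE iter_unshiftE addnK.
by rewrite ltnNge leq_addl.
Qed.

Lemma periodic_partE k x n : periodic_part k x n = x (n %% k.-1)%N.
Proof.
rewrite linf_ofE//; apply/asboolP.
by exists `|x| => i; exact: le_linf_norm.
Qed.

Lemma bounded_linear_shift m : bounded_linear (fun x => s^[m] x).
Proof.
split=> [a x y|]; first by apply: linf_ext => n; rewrite !(iter_shiftE, linfDE, linfZE).
exists 1 => x; rewrite mul1r; apply: linf_norm_le => n.
by rewrite iter_shiftE le_linf_norm.
Qed.

Lemma bounded_linear_unshift m : bounded_linear (fun x => st^[m] x).
Proof.
split=> [a x y|].
  apply: linf_ext => n; rewrite !(iter_unshiftE, linfDE, linfZE).
  by case: ifP => _ //; rewrite mulr0 addr0.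
exists 1 => x; rewrite mul1r; apply: linf_norm_le => n.
by rewrite iter_unshiftE; case: ifP => _; rewrite ?normr0 ?le_linf_norm.
Qed.

Lemma bounded_linear_periodic_part k : bounded_linear (fun x => periodic_part k x).
Proof.
split=> [a x y|].
  by apply: linf_ext => n; rewrite !(periodic_partE, linfDE, linfZE).
exists 1 => x; rewrite mul1r; apply: linf_norm_le => n.
by rewrite periodic_partE le_linf_norm.
Qed.

Lemma bounded_bilinear_linf_mul : bounded_bilinear (@linf_mul R).
Proof.
split=> [x a y z|x a y z|].
- by apply: linf_ext => n; rewrite !(linf_mulE, linfDE, linfZE) mulrDr mulrCA.
- by apply: linf_ext => n; rewrite !(linf_mulE, linfDE, linfZE) mulrDl mulrA.
exists 1 => // x y; rewrite mul1r; apply: linf_norm_le => n.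
by rewrite linf_mulE normrM ler_pM// le_linf_norm.
Qed.

Lemma le_l1_norm_series r n : series (fun i => `|r i|) n <= `|r|.
Proof.
apply: nondecreasing_cvgn_le; last exact: l1P.
by apply: nondecreasing_series => i _.
Qed.

Lemma l1_norm_le r M : (forall n, series (fun i => `|r i|) n <= M) -> `|r| <= M.
Proof.
move=> rM; apply: limr_le; first exact: l1P.
by near=> n; exact: rM.
Unshelve. all: by end_near. Qed.

Lemma bounded_bilinear_l1_mul : bounded_bilinear (@l1_mul R).
Proof.
split=> [x a r r'|r a x y|].
- apply: l1_ext => n.
  change (x n * (a * r n + r' n) = a * (x n * r n) + x n * r' n).
  by rewrite mulrDr mulrCA.
- apply: l1_ext => n.
  change ((a * x n + y n) * r n = a * (x n * r n) + y n * r n).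
  by rewrite mulrDl mulrA.
exists 1 => // x r; rewrite mul1r; apply: l1_norm_le => n.
apply: (@le_trans _ _ (`|x| * series (fun i => `|r i|) n)); last first.
  by rewrite ler_wpM2l// le_l1_norm_series.
rewrite /series/= mulr_sumr ler_sum// => i _.
by rewrite normrM ler_wpM2r// le_linf_norm.
Qed.

Lemma bounded_linear_unshift1 m : bounded_linear (fun r => st1^[m] r).
Proof.
elim: m => [|m IH]; first exact: bounded_linear_id.
apply: (@bounded_linear_comp _ _ _ _ (@l1_unshift R)) IH; split.
  move=> a r r'; apply: l1_ext => -[|n] //.
  by change (0 = a * 0 + 0 :> R); rewrite mulr0 addr0.
exists 1 => r; rewrite mul1r; apply: l1_norm_le => -[|n].
  by rewrite /series/= big_geq.
rewrite /series/= big_nat_recl//= normr0 add0r.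
exact: le_l1_norm_series.
Qed.

(** The interior of the positive cone of [linf]. On it the componentwise inverse and logarithm are
    bounded, so the default value of [linf_of] does not occur. *)
Definition linf_pos : set (linf R) :=
  [set x | exists2 e : R, 0 < e & forall n, e <= x n].

Lemma linf_pos_gt0 x n : linf_pos x -> 0 < x n.
Proof. by move=> [e e0 /(_ n)]; exact: lt_le_trans. Qed.

Lemma linf_pos_neq0 x n : linf_pos x -> x n != 0.
Proof. by move=> x0; rewrite gt_eqF// linf_pos_gt0. Qed.

Lemma open_linf_pos : open linf_pos.
Proof.
rewrite openE => x [e e0 ex]; apply/nbhs_ballP; exists (e / 2) => /=.
  by rewrite divr_gt0.
move=> y; rewrite -ball_normE /= => xy; exists (e / 2); first by rewrite divr_gt0.
move=> n; have := ltW (le_lt_trans (le_linf_norm (x - y) n) xy).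
rewrite linfBE => /(le_trans (ler_norm _)); have := ex n; lra.
Qed.

Lemma linf_invE x n : linf_pos x -> linf_inv x n = (x n)^-1.
Proof.
move=> xp; have [e e0 ex] := xp; rewrite linf_ofE//; apply/asboolP.
exists e^-1 => i; have xi := linf_pos_gt0 i xp.
by rewrite normfV gtr0_norm// lef_pV2 ?posrE.
Qed.

Lemma linf_lnE x n : linf_pos x -> linf_ln x n = ln (x n).
Proof.
move=> xp; have [e e0 ex] := xp; rewrite linf_ofE//; apply/asboolP.
exists (`|ln e| + `|ln `|x| |) => i; have xi := linf_pos_gt0 i xp.
have lo : ln e <= ln (x i) by rewrite ler_ln ?posrE.
have xle : x i <= `|x| by rewrite (le_trans _ (le_linf_norm x i))// ler_norm.
have hi : ln (x i) <= ln `|x| by rewrite ler_ln ?posrE// (lt_le_trans xi).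
have := normr_ge0 (ln e); have := normr_ge0 (ln `|x|).
have := ler_norm (ln `|x|); have := ler_norm (- ln e); rewrite normrN.
by rewrite ler_norml => *; apply/andP; split; lra.
Qed.

Lemma linf_pos_mul x y : linf_pos x -> linf_pos y -> linf_pos (x *oo y).
Proof.
move=> [e e0 ex] [d d0 dy]; exists (e * d); first by rewrite mulr_gt0.
by move=> n; rewrite linf_mulE ler_pM// ltW.
Qed.

Lemma linf_pos_inv x : linf_pos x -> linf_pos (linf_inv x).
Proof.
move=> xp; have [e e0 ex] := xp.
have x0 : 0 < `|x|.
  rewrite (lt_le_trans (linf_pos_gt0 0 xp))//.
  by rewrite (le_trans _ (le_linf_norm x 0))// ler_norm.
exists `|x|^-1; first by rewrite invr_gt0.
move=> n; rewrite linf_invE// lef_pV2 ?posrE ?linf_pos_gt0//.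
by rewrite (le_trans _ (le_linf_norm x n))// ler_norm.
Qed.

Lemma linf_pos_exp x : linf_pos (linf_exp x).
Proof.
exists (expR (- `|x|)); first exact: expR_gt0.
move=> n; rewrite linf_expE ler_expR lerNl (le_trans _ (le_linf_norm x n))//.
by rewrite -normrN ler_norm.
Qed.

Lemma linf_pos_one : linf_pos (@linf_one R).
Proof. by exists 1. Qed.

Lemma linf_lnK x : linf_pos x -> linf_exp (linf_ln x) = x.
Proof.
by move=> xp; apply: linf_ext => n; rewrite linf_expE linf_lnE// lnK// posrE linf_pos_gt0.
Qed.

Lemma linf_expK x : linf_ln (linf_exp x) = x.
Proof.
by apply: linf_ext => n; rewrite linf_lnE ?linf_expE ?expRK//; exact: linf_pos_exp.
Qed.

Lemma linf_ln_mul x y : linf_pos x -> linf_pos y ->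
  linf_ln (x *oo y) = linf_ln x + linf_ln y.
Proof.
move=> xp yp; apply: linf_ext => n; rewrite linfDE !linf_lnE//.
  by rewrite lnM// posrE linf_pos_gt0.
exact: linf_pos_mul.
Qed.

Lemma near0_le (E : normedModType R) (e : R) : 0 < e ->
  \forall h \near (0 : E), `|h| <= e.
Proof. by move=> e0; apply/nbhs_norm0P; exists e => //= y /ltW. Qed.

(** The remainder has entries [expR x_n (expR h_n - 1 - h_n)]; the scalar estimate applies to all
    [n] at once when [|h| <= 1/2]. *)
Lemma is_diff_linf_exp x : is_diff x linf_exp (fun h => linf_exp x *oo h).
Proof.
apply: (@is_diff_quadratic _ _ _ _ _ _ (`|linf_exp x| * 2)).
  exact: bounded_bilinearl bounded_bilinear_linf_mul.
have e0 : 0 < 2^-1 :> R by rewrite invr_gt0.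
have := @near0_le (linf R) _ e0; apply: filterS => h hle.
apply: linf_norm_le => n.
have -> : (linf_exp (h + x) - linf_exp x - linf_exp x *oo h) n
    = linf_exp x n * (expR (h n) - 1 - h n).
  rewrite !(linfBE, linf_expE, linf_mulE, linfDE) expRD.
  by rewrite !mulrBr mulr1 [expR (h n) * _]mulrC.
rewrite normrM -mulrA ler_pM//; first exact: le_linf_norm.
have hn := le_linf_norm h n.
apply: (le_trans (expR_remainder (le_trans hn hle))).
by rewrite ler_wpM2l// -real_normK ?num_real// lerXn2r ?nnegrE.
Qed.

Lemma is_diff_linf_ln x : linf_pos x ->
  is_diff x linf_ln (fun h => linf_inv x *oo h).
Proof.
move=> xp; apply: (@is_diff_quadratic _ _ _ _ _ _ (2 * `|linf_inv x| ^+ 2)).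
  exact: bounded_bilinearl bounded_bilinear_linf_mul.
have N0 : 0 < `|linf_inv x| + 1 by rewrite ltr_pwDr.
(* This radius forces [|h_n / x_n| <= 1/2] for every [n]; the summand 1 makes the denominator
   positive. *)
have e0 : 0 < 2^-1 / (`|linf_inv x| + 1) by rewrite divr_gt0// invr_gt0.
have := @near0_le (linf R) _ e0; apply: filterS => h hle.
have tle n : `|h n / x n| <= `|h| * `|linf_inv x|.
  by rewrite normrM -linf_invE// ler_pM// le_linf_norm.
have t2 n : `|h n / x n| <= 2^-1.
  apply: (le_trans (tle n)); move: hle; rewrite ler_pdivlMr//; apply: le_trans.
  by rewrite ler_wpM2l// lerDl.
have xhE n : (h + x) n = x n * (1 + h n / x n).
  rewrite mulrDr mulr1 mulrC divfK; first by rewrite addrC.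
  exact: linf_pos_neq0.
have p1 n : 2^-1 <= 1 + h n / x n.
  by have := t2 n; rewrite ler_norml => /andP[? _]; lra.
have hxp : linf_pos (h + x).
  have [e ep ex] := xp; exists (e * 2^-1); first by rewrite mulr_gt0// invr_gt0.
  by move=> n; rewrite xhE ler_pM//; apply: ltW.
apply: linf_norm_le => n.
have -> : (linf_ln (h + x) - linf_ln x - linf_inv x *oo h) n
    = ln (1 + h n / x n) - h n / x n.
  rewrite !(linfBE, linf_mulE) !linf_lnE// linf_invE// xhE lnM ?posrE.
  - by rewrite [_^-1 * _]mulrC [ln _ + _]addrC addrK.
  - exact: linf_pos_gt0.
  - by rewrite (lt_le_trans _ (p1 n))// invr_gt0.
apply: (le_trans (ln1D_remainder (t2 n))).
rewrite -mulrA ler_wpM2l// -exprMn -real_normK ?num_real// lerXn2r ?nnegrE ?mulr_ge0//.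
by rewrite [leRHS]mulrC.
Qed.

(** The remainder is [h^2 / (x^2 (x + h))]. For [|h| <= e / 2] one has [x_n + h_n >= x_n / 2],
    whence the factor 2 and the cube of the norm of the inverse. *)
Lemma is_diff_linf_inv x : linf_pos x ->
  is_diff x linf_inv (fun h => - (linf_inv x *oo linf_inv x *oo h)).
Proof.
move=> xp; have [e e0 ex] := xp.
apply: (@is_diff_quadratic _ _ _ _ _ _ (2 * `|linf_inv x| ^+ 3)).
  apply: bounded_linearN; exact: bounded_bilinearl bounded_bilinear_linf_mul.
have e2 : 0 < e / 2 by rewrite divr_gt0.
have := @near0_le (linf R) _ e2; apply: filterS => h hle.
have xh n : x n / 2 <= h n + x n.
  have := le_trans (le_linf_norm h n) hle; rewrite ler_norml => /andP[? _].
  have := ex n; lra.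
have hxp : linf_pos (h + x).
  by exists (e / 2) => // n; have := xh n; have := ex n; rewrite linfDE; lra.
apply: linf_norm_le => n.
have xn := linf_pos_gt0 n xp; have hxn := linf_pos_gt0 n hxp.
have -> : (linf_inv (h + x) - linf_inv x - - (linf_inv x *oo linf_inv x *oo h)) n
    = (h n + x n)^-1 * (linf_inv x n ^+ 2 * h n ^+ 2).
  rewrite !(linfBE, linfNE, linf_mulE) !linf_invE// linfDE.
  by field; rewrite ?gt_eqF.
have hn := le_linf_norm h n; have xin := le_linf_norm (linf_inv x) n.
have -> : 2 * `|linf_inv x| ^+ 3 * `|h| ^+ 2 =
  (2 * `|linf_inv x|) * (`|linf_inv x| ^+ 2 * `|h| ^+ 2) by ring.
rewrite !normrM ler_pM ?mulr_ge0 ?exprn_ge0//; last first.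
  by rewrite !expr2 !ler_pM ?mulr_ge0.
apply: (@le_trans _ _ (2 * `|linf_inv x n|)); last by rewrite ler_wpM2l.
rewrite linf_invE// !normfV !gtr0_norm// -[2 in leRHS]invrK -invfM.
by rewrite lef_pV2 ?posrE// ?mulr_gt0 ?invr_gt0// mulrC.
Qed.

Lemma is_Cn_linf_mul n (E : normedModType R) (U : set E) (f g : E -> linf R) :
  open U -> is_Cn n U f -> is_Cn n U g -> is_Cn n U (fun u => f u *oo g u).
Proof. by move=> oU; exact: is_Cn_bilinear oU bounded_bilinear_linf_mul. Qed.

(** The differential is the exponential itself times a linear factor, so its order of smoothness is
    that of the induction hypothesis. *)
Lemma is_Cn_linf_exp n : is_Cn n setT (@linf_exp R).
Proof.
elim: n => [|n IH].
  move=> x _; apply: differentiable_continuous; by have [] := is_diff_linf_exp x.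
apply: (@is_CnS _ _ _ _ _ _ (fun x h => linf_exp x *oo h)); first exact: openT.
  by move=> x _; exact: is_diff_linf_exp.
have oT : open (@setT (linf R) `*` @setT (linf R)) by rewrite setXTT; exact: openT.
apply: (is_Cn_linf_mul oT); last exact/is_Cn_bounded_linear/bounded_linear_snd.
apply: (is_Cn_comp oT openT) IH => //.
exact/is_Cn_bounded_linear/bounded_linear_fst.
Qed.

Lemma is_Cn_linf_inv n : is_Cn n linf_pos (@linf_inv R).
Proof.
elim: n => [|n IH].
  move=> x xp; apply: differentiable_continuous; by have [] := is_diff_linf_inv xp.
apply: (@is_CnS _ _ _ _ _ _ (fun x h => - (linf_inv x *oo linf_inv x *oo h))).
- exact: open_linf_pos.
- by move=> x xp; exact: is_diff_linf_inv.
have oT : open (linf_pos `*` @setT (linf R)).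
  by apply: open_setX; [exact: open_linf_pos|exact: openT].
have invn : is_Cn n (linf_pos `*` @setT (linf R)) (fun xv => linf_inv xv.1).
  apply: (is_Cn_comp oT open_linf_pos) IH; first by move=> xv [].
  exact/is_Cn_bounded_linear/bounded_linear_fst.
apply: is_CnN => //; apply: is_Cn_linf_mul => //; first exact: is_Cn_linf_mul.
exact/is_Cn_bounded_linear/bounded_linear_snd.
Qed.

(** A case distinction suffices: the differential involves only the inverse, whose smoothness is
    already established. *)
Lemma is_Cn_linf_ln n : is_Cn n linf_pos (@linf_ln R).
Proof.
case: n => [|n].
  move=> x xp; apply: differentiable_continuous; by have [] := is_diff_linf_ln xp.
apply: (@is_CnS _ _ _ _ _ _ (fun x h => linf_inv x *oo h)).
- exact: open_linf_pos.
- by move=> x xp; exact: is_diff_linf_ln.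
have oT : open (linf_pos `*` @setT (linf R)).
  by apply: open_setX; [exact: open_linf_pos|exact: openT].
apply: (is_Cn_linf_mul oT); last exact/is_Cn_bounded_linear/bounded_linear_snd.
apply: (is_Cn_comp oT open_linf_pos) (is_Cn_linf_inv n); first by move=> xv [].
exact/is_Cn_bounded_linear/bounded_linear_fst.
Qed.

End sequences.

(** * The group and its cosets *)

Section group_law.
Context {R : realType}.
Variable k : nat.
Local Notation elt := (linf R * linf R)%type.
Implicit Types (x y z : linf R) (g h u v : elt).

Lemma linf0E n : (0 : linf R) n = 0. Proof. by []. Qed.

Definition linfE := (@iter_shiftE R, linf0E, @linfDE R, @linfBE R, @linfNE R,
  @linf_mulE R, @linf_expE R).

Lemma linf_mulA x y z : x *oo (y *oo z) = x *oo y *oo z.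
Proof. by apply: linf_ext => n; rewrite !linfE mulrA. Qed.

Lemma linf_mulC x y : x *oo y = y *oo x.
Proof. by apply: linf_ext => n; rewrite !linfE mulrC. Qed.

Lemma linf_mul0 x : x *oo 0 = 0.
Proof. by apply: linf_ext => n; exact: mulr0. Qed.

Lemma linf_mulVK x y : linf_pos x -> x *oo (linf_inv x *oo y) = y.
Proof.
by move=> xp; apply: linf_ext => n; rewrite !linfE linf_invE// mulVKf// linf_pos_neq0.
Qed.

Lemma linf_mulKV x y : linf_pos x -> linf_inv x *oo (x *oo y) = y.
Proof.
by move=> xp; apply: linf_ext => n; rewrite !linfE linf_invE// mulKf// linf_pos_neq0.
Qed.

Lemma linf_inv_mul x y : linf_pos x -> linf_pos y ->
  linf_inv (x *oo y) = linf_inv x *oo linf_inv y.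
Proof.
move=> xp yp; apply: linf_ext => n.
by rewrite linf_invE ?linfE ?linf_invE ?invfM//; exact: linf_pos_mul.
Qed.

Lemma linf_shift_pos m x : linf_pos x -> linf_pos (s^[m] x).
Proof. by move=> [e e0 ex]; exists e => // n; rewrite iter_shiftE. Qed.

Lemma linf_expD x y : linf_exp (x + y) = linf_exp x *oo linf_exp y.
Proof. by apply: linf_ext => n; rewrite !linfE expRD. Qed.

Lemma linf_exp_shift m x : linf_exp (s^[m] x) = s^[m] (linf_exp x).
Proof. by apply: linf_ext => n; rewrite !linfE. Qed.

Lemma linf_ln_shift m x : linf_pos x -> linf_ln (s^[m] x) = s^[m] (linf_ln x).
Proof.
move=> xp; apply: linf_ext => n; rewrite !(linfE, linf_lnE)//.
exact: linf_shift_pos.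
Qed.

Lemma shift_periodic_part x : s^[k.-1] (periodic_part k x) = periodic_part k x.
Proof. by apply: linf_ext => n; rewrite iter_shiftE !periodic_partE modnDr. Qed.

(** Write [n = q (k - 1) + r] and use the periodicity [q] times. *)
Lemma periodic_part_id x : s^[k.-1] x = x -> periodic_part k x = x.
Proof.
move=> xk; apply: linf_ext => n; rewrite periodic_partE [in RHS](divn_eq n k.-1).
elim: (n %/ k.-1)%N => [|q IH]; first by rewrite mul0n add0n.
by rewrite mulSnr addnAC -iter_shiftE xk.
Qed.

(** The entries dropped by the shift are zero: the first [k - 1] entries of [x] and of its periodic
    part coincide. *)
Lemma unshift_shift x :
  st^[k.-1] (s^[k.-1] (x - periodic_part k x)) = x - periodic_part k x.
Proof.
apply: linf_ext => n; rewrite iter_unshiftE; case: ltnP => nk.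
  by rewrite linfBE periodic_partE modn_small// subrr.
by rewrite iter_shiftE subnK.
Qed.

(** Indices [n %% k.-1] fall among the leading zeros. The hypothesis [k >= 2] enters the proof here:
    for [k.-1 = 0] the remainder would be [n] itself. *)
Lemma periodic_part_unshift x : (0 < k.-1)%N ->
  periodic_part k (st^[k.-1] x) = 0.
Proof.
by move=> k0; apply: linf_ext => n; rewrite periodic_partE iter_unshiftE ltn_mod k0.
Qed.

Lemma kmulA : associative (@kmul R k).
Proof.
move=> g h u; congr pair; first exact: linf_mulA.
by apply: linf_ext => n; rewrite !linfE; ring.
Qed.

Lemma kmul1g : left_id (@kone R) (kmul k).
Proof.
move=> [g0 g1]; congr pair; apply: linf_ext => n; rewrite !linfE /= ?mul1r//.
by rewrite mul0r addr0.
Qed.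

Lemma kmulg1 : right_id (@kone R) (kmul k).
Proof.
move=> [g0 g1]; congr pair; apply: linf_ext => n; rewrite !linfE /= ?mulr1//.
by rewrite mulr0 add0r.
Qed.

Lemma kmulVg g : GI g -> kmul k (kinv k g) g = kone.
Proof.
move=> gp; congr pair; apply: linf_ext => n; rewrite !linfE !linf_invE//.
  by rewrite mulVf// linf_pos_neq0.
by field; rewrite !linf_pos_neq0.
Qed.

Lemma kmulgV g : GI g -> kmul k g (kinv k g) = kone.
Proof.
move=> gp; congr pair; apply: linf_ext => n; rewrite !linfE !linf_invE//.
  by rewrite mulfV// linf_pos_neq0.
by field; rewrite !linf_pos_neq0.
Qed.

Lemma GI1 : GI (@kone R).
Proof. exact: linf_pos_one. Qed.

Lemma GI_mul g h : GI g -> GI h -> GI (kmul k g h).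
Proof. exact: linf_pos_mul. Qed.

Lemma GI_inv g : GI g -> GI (kinv k g).
Proof. exact: linf_pos_inv. Qed.

Lemma GL0_GI u : GL0 k u -> GI u. Proof. by case. Qed.

Lemma GL0_exp x : s^[k.-1] x = x -> GL0 k (linf_exp x, 0).
Proof.
by move=> xk; split => //=; [exact: linf_pos_exp | rewrite -linf_exp_shift xk].
Qed.

Lemma GL01 : GL0 k (@kone R).
Proof.
by split; [exact: GI1 | | apply: linf_ext => n; rewrite iter_shiftE].
Qed.

Lemma GL0_mul u v : GL0 k u -> GL0 k v -> GL0 k (kmul k u v).
Proof.
move=> [up u2 u1] [vp v2 v1]; split; first exact: GI_mul.
  by rewrite /kmul u2 v2; apply: linf_ext => n; rewrite !linfE mulr0 mul0r addr0.
apply: linf_ext => n; rewrite !linfE /= -!iter_shiftE.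
by rewrite u1 v1.
Qed.

Lemma GL0_inv u : GL0 k u -> GL0 k (kinv k u).
Proof.
move=> [up u2 u1]; split; first exact: GI_inv.
  by rewrite /kinv u2; apply: linf_ext => n; rewrite !linfE mulr0 mul0r oppr0.
by apply: linf_ext => n; rewrite !linfE /= !linf_invE// -iter_shiftE u1.
Qed.

(** Shift-invariance of [u.1] lets it commute past [S^{k-1}]. This centrality makes the coset
    operations well defined. *)
Lemma kmul_GL0C u g : GL0 k u -> kmul k u g = kmul k g u.
Proof.
move=> [_ u2 u1]; rewrite /kmul u2 u1; congr pair; first exact: linf_mulC.
by apply: linf_ext => n; rewrite !linfE /= mul0r mulr0 addr0 add0r mulrC.
Qed.

Lemma kmul_GL0ACA g u h v : GL0 k u ->
  kmul k (kmul k g u) (kmul k h v) = kmul k (kmul k g h) (kmul k u v).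
Proof. by move=> uL; rewrite -!kmulA (kmulA u) (kmul_GL0C h uL) -kmulA. Qed.

Lemma kcoset_refl g : kcoset k g g.
Proof. by exists kone; [exact: GL01|exact: kmulg1]. Qed.

Lemma kcoset_mulr g u : GL0 k u -> kcoset k (kmul k g u) = kcoset k g.
Proof.
move=> uL; apply/seteqP; split => _ [v vL <-].
  by exists (kmul k u v); [exact: GL0_mul|rewrite kmulA].
exists (kmul k (kinv k u) v); first by apply: GL0_mul => //; exact: GL0_inv.
by rewrite -kmulA [kmul k u _]kmulA kmulgV ?kmul1g//; exact: GL0_GI.
Qed.

Lemma kcoset_eqP g h :
  kcoset k g = kcoset k h <-> exists2 u, GL0 k u & h = kmul k g u.
Proof.
split=> [gh|[u uL ->]]; last by rewrite kcoset_mulr.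
by have := kcoset_refl h; rewrite -gh => -[u uL <-]; exists u.
Qed.

(** Lets any [GL0]-invariant expression in the representative chosen by [get] be evaluated at
    [g]. *)
Lemma get_kcoset g : exists2 u, GL0 k u & get (kcoset k g) = kmul k g u.
Proof. by have [u uL <-] := getPex (ex_intro _ g (kcoset_refl g)); exists u. Qed.

Lemma kcoset_kone : kcoset k (@kone R) = GL0 k.
Proof.
apply/seteqP; split => [_ [u uL <-]|u uL]; first by rewrite kmul1g.
by exists u => //; rewrite kmul1g.
Qed.

Lemma kcoset_mul g h :
  [set kmul k a b | a in kcoset k g & b in kcoset k h] = kcoset k (kmul k g h).
Proof.
apply/seteqP; split => [_ [_ [u uL <-] [_ [v vL <-] <-]]|_ [u uL <-]].
  by exists (kmul k u v); [exact: GL0_mul|rewrite (kmul_GL0ACA g h v uL)].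
exists g; first exact: kcoset_refl.
by exists (kmul k h u); [exists u|rewrite kmulA].
Qed.

Lemma kinv_kmul g u : GI g -> GL0 k u ->
  kinv k (kmul k g u) = kmul k (kinv k g) (kinv k u).
Proof.
move=> gp uL; have up := GL0_GI uL; have gup := GI_mul gp up.
have e : kmul k (kmul k g u) (kmul k (kinv k g) (kinv k u)) = kone.
  by rewrite kmul_GL0ACA// !kmulgV// kmulg1.
(* Both sides are inverse to [kmul k g u]. *)
by rewrite -[RHS]kmul1g -(kmulVg gup) -kmulA e kmulg1.
Qed.

Lemma kcoset_inv g : GI g -> kinv k @` kcoset k g = kcoset k (kinv k g).
Proof.
move=> gp; apply/seteqP; split => [_ [_ [u uL <-] <-]|_ [u uL <-]].
  by exists (kinv k u); [exact: GL0_inv|rewrite kinv_kmul].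
exists (kmul k g (kinv k u)); first by exists (kinv k u) => //; exact: GL0_inv.
rewrite kinv_kmul//; last exact: GL0_inv.
congr kmul; have up := GL0_GI uL.
by rewrite -[RHS]kmulg1 -(kmulgV (GI_inv up)) kmulA kmulgV// kmul1g.
Qed.

(* The chart [coset_chart] read on representatives. *)
Definition coset_coord g : elt :=
  (s^[k.-1] (linf_ln g.1 - periodic_part k (linf_ln g.1)), linf_inv g.1 *oo g.2).

(** Multiplication by [u] adds the periodic sequence [linf_ln u.1] to the logarithm, and subtracting
    the periodic part removes it. In the second coordinate [u.1] cancels because it equals its own
    shift. *)
Lemma coset_coord_kmul g u : GI g -> GL0 k u ->
  coset_coord (kmul k g u) = coset_coord g.
Proof.
move=> gp [up u2 u1]; rewrite /coset_coord; congr pair.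
  rewrite linf_ln_mul//; apply: linf_ext => n; rewrite !linfE !periodic_partE !linfE.
  have := periodic_part_id (x := linf_ln u.1); rewrite -linf_ln_shift// u1.
  move=> /(_ erefl) lnu.
  rewrite -[X in _ - (_ + X)](periodic_partE k (linf_ln u.1)) lnu.
  by rewrite opprD addrACA subrr addr0.
rewrite /kmul /= u2 u1 linf_inv_mul//; apply: linf_ext => n; rewrite !linfE.
by rewrite mulr0 add0r !linf_invE//; field; rewrite !linf_pos_neq0.
Qed.

Lemma coset_chartE g : GI g -> coset_chart k (kcoset k g) = coset_coord g.
Proof.
move=> gp; rewrite -[LHS]/(coset_coord (get (kcoset k g))).
by have [u uL ->] := get_kcoset g; rewrite coset_coord_kmul.
Qed.

Lemma coset_chart_coord C g : GI g -> C = kcoset k g ->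
  coset_coord g = coset_chart k C.
Proof. by move=> gp ->; rewrite coset_chartE. Qed.

(** The representative whose logarithm has its first [k - 1] entries equal to zero. *)
Definition coset_lift (u : elt) : elt :=
  let g0 := linf_exp (st^[k.-1] u.1) in (g0, g0 *oo u.2).

Lemma GI_coset_lift u : GI (coset_lift u).
Proof. exact: linf_pos_exp. Qed.

Lemma coset_lift_coord g : GI g ->
  exists2 u, GL0 k u & coset_lift (coset_coord g) = kmul k g u.
Proof.
(* Lifting the coordinates discards the periodic part of [linf_ln g.1], hence this factor. *)
move=> gp; exists (linf_exp (- periodic_part k (linf_ln g.1)), 0).
  apply: GL0_exp; rewrite -[in RHS]shift_periodic_part.
  by apply: linf_ext => n; rewrite !linfE.
rewrite /coset_lift /= unshift_shift linf_expD linf_lnK// /kmul /=; congr pair.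
apply: linf_ext => n; rewrite !linfE !linf_invE//.
rewrite -(iter_shiftE k.-1 (periodic_part k _)) shift_periodic_part.
rewrite mulr0 add0r.
by field; rewrite linf_pos_neq0.
Qed.

Lemma coset_chartK C : (kcoset k @` GI) C ->
  cinv (@coset_chart R k) (coset_chart k C) = C.
Proof.
move=> [g gp <-]; rewrite coset_chartE// -[LHS]/(kcoset k (coset_lift _)).
by have [u uL ->] := coset_lift_coord gp; rewrite kcoset_mulr.
Qed.

Lemma coset_coord_lift u : (0 < k.-1)%N -> coset_coord (coset_lift u) = u.
Proof.
move=> k0; case: u => u0 u1; rewrite /coset_coord /coset_lift /=.
rewrite linf_mulKV ?linf_expK; last exact: linf_pos_exp.
by rewrite periodic_part_unshift// subr0 shift_unshift.
Qed.

End group_law.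

(** * Manifolds with a global chart *)

Section global_charts.
Context {R : realType}.
Implicit Types M N : manifold R.

(** The manifolds of the first row and their products have one-chart atlases, so smoothness need
    only be checked in a single pair of charts. *)
Definition global_chart M (c : chart (mpoint M) (mmodel M)) : Prop :=
  [/\ @matlas R M = [set c], cdom c = @mcarrier R M,
      open (c @` @mcarrier R M) &
      forall x, @mcarrier R M x -> cinv c (c x) = x].

Lemma global_chart_at M c x d : @global_chart M c -> chart_at M x d -> d = c.
Proof. by move=> [cM _ _ _] []; rewrite cM. Qed.

Lemma chart_at_global M c x : @global_chart M c -> @mcarrier R M x ->
  chart_at M x c.
Proof. by move=> [cM cd _ _] Mx; split; rewrite ?cM ?cd. Qed.

(** The only transition map is the identity on the image of the chart, and points are separated by
    pulling back disjoint open sets of the model. *)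
Lemma global_chart_banach_manifold M c : @global_chart M c -> is_banach_manifold M.
Proof.
move=> cg; have [cM cd cO cK] := cg; split.
- by move=> d; rewrite cM => ->; rewrite cd; split.
- by move=> x Mx; exists c; exact: chart_at_global.
- move=> d d'; rewrite cM => -> ->; rewrite cd setIid; split => // n.
  apply: (@is_Cn_ext _ _ _ _ _ id) => //; last first.
    exact/is_Cn_bounded_linear/bounded_linear_id.
  by move=> u; rewrite inE => -[x Mx <-] /=; rewrite cK.
move=> x y Mx My xy; have cxy : c x != c y.
  by apply/eqP => /(congr1 (cinv c)); rewrite !cK.
have := @norm_hausdorff _ (mmodel M); rewrite open_hausdorff.
move=> /(_ _ _ cxy)[[A B] /= [Ax By] [oA oB AB]].
exists c, c, A, B; split => //; try exact: chart_at_global.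
- by move: Ax; rewrite inE.
- by move: By; rewrite inE.
apply/seteqP; split => // z [[_ Az] [_ Bz]].
have : (A `&` B) (c z) by [].
by rewrite (eqP AB).
Qed.

Lemma global_chart_prod M N c d : @global_chart M c -> @global_chart N d ->
  @global_chart (prod_manifold M N) (prod_chart c d).
Proof.
move=> [cM cd cO cK] [dN dd dO dK]; split.
- apply/seteqP; split => [e [c' [d' []]]|e ->] /=.
    by rewrite cM dN => -> ->.
  by exists c, d; rewrite cM dN.
- by rewrite /prod_chart /= cd dd.
- rewrite (_ : _ @` _ = (c @` @mcarrier R M) `*` (d @` @mcarrier R N)).
    exact: open_setX.
  apply/seteqP; split => [_ [[x y] [Mx Ny] <-]|[u v] [[x Mx xu] [y Ny yv]]].
    by split; [exists x|exists y].
  by exists (x, y) => //; congr pair.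
by move=> [x y] [Mx Ny]; rewrite /= cK// dK.
Qed.

Lemma global_chart_smooth_map M N c d f : @global_chart M c -> @global_chart N d ->
  set_fun (@mcarrier R M) (@mcarrier R N) f ->
  smooth_on (c @` @mcarrier R M) (d \o f \o cinv c) -> @smooth_map R M N f.
Proof.
move=> [cM cd cO cK] [dN dd dO dK] MNf fs; split => // c' d'.
rewrite cM dN => -> -> /=; by rewrite cd dd setIidl.
Qed.

End global_charts.

(** * Global charts of the subgroup, the group and the quotient *)

Section charts.
Context {R : realType}.
Variable k : nat.
Local Notation elt := (linf R * linf R)%type.
Local Notation GI_chart := (@Chart elt elt (@GI R) id id).
Local Notation GL0_chart := (@Chart elt (L0 R k) (GL0 k)
  (fun g => insubd (0 : L0 R k) g.1) (fun x => (L0_val x, 0))).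

(** A bounded linear retraction onto the periodic sequences. The argument of [insubd] is always
    periodic, so the default 0 stands for no other value. *)
Definition L0_proj (x : linf R) : L0 R k := insubd 0 (periodic_part k x).

Lemma L0_projE x : L0_val (L0_proj x) = periodic_part k x.
Proof. by rewrite insubdK//; apply/eqP; exact: shift_periodic_part. Qed.

Lemma L0_projK : cancel L0_val L0_proj.
Proof.
move=> x; apply: val_inj; rewrite /= L0_projE periodic_part_id//.
exact/eqP/(valP x).
Qed.

Lemma bounded_linear_L0_val : bounded_linear (@L0_val R k).
Proof. by split => //; exists 1 => x; rewrite mul1r. Qed.

Lemma bounded_linear_L0_proj : bounded_linear L0_proj.
Proof.
have [lin [M pM]] := @bounded_linear_periodic_part R k; split.
  by move=> a x y; apply: val_inj; rewrite /= !L0_projE lin -!L0_projE.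
by exists M => x; rewrite -[`|L0_proj x|]/`|L0_val (L0_proj x)| L0_projE.
Qed.

Lemma GIE : @GI R = linf_pos `*` setT.
Proof. by apply/seteqP; split => [g gp|g [gp _]]. Qed.

Lemma open_GI : open (@GI R).
Proof. by rewrite GIE; apply: open_setX; [exact: open_linf_pos|exact: openT]. Qed.

Lemma GI_global_chart : @global_chart R (GI_lie k) GI_chart.
Proof. by split => //; rewrite image_id; exact: open_GI. Qed.

Lemma GL0_chart_image : GL0_chart @` GL0 k = [set x : L0 R k | linf_pos (L0_val x)].
Proof.
have gL g : GL0 k g -> L0_val (insubd (0 : L0 R k) g.1) = g.1.
  by move=> [_ _ gk]; rewrite insubdK//; exact/eqP.
apply/seteqP; split => [_ [g gL0 <-] /=|x xp].
  by rewrite gL//; case: gL0.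
exists (L0_val x, 0); last by apply: val_inj; rewrite /= insubdK//; exact: valP.
by split => //; exact/eqP/(valP x).
Qed.

Lemma open_GL0_chart : open (GL0_chart @` GL0 k).
Proof.
rewrite GL0_chart_image; apply: (@open_comp _ _ (@L0_val R k)); last first.
  exact: open_linf_pos.
by have [L -> Lc] := bounded_linear_pack bounded_linear_L0_val => x _; exact: Lc.
Qed.

Lemma GL0_chartK g : GL0 k g -> cinv GL0_chart (GL0_chart g) = g.
Proof.
move=> [gp g2 gk]; rewrite /= insubdK; last exact/eqP.
by rewrite -g2; case: g {gp g2 gk}.
Qed.

Lemma GL0_global_chart : @global_chart R (GL0_lie k) GL0_chart.
Proof. by split => //; [exact: open_GL0_chart|exact: GL0_chartK]. Qed.

Hypothesis k_gt0 : (0 < k.-1)%N.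

(** Every [u] is the coordinate of its lift: the chart identifies the quotient with the whole model
    space. *)
Lemma coset_chart_image : @coset_chart R k @` (kcoset k @` GI) = setT.
Proof.
apply/seteqP; split => // u _; exists (kcoset k (coset_lift k u)).
  by exists (coset_lift k u) => //; exact: GI_coset_lift.
by rewrite coset_chartE ?coset_coord_lift//; exact: GI_coset_lift.
Qed.

Lemma GQ_global_chart : @global_chart R (GQ_lie k) (coset_chart k).
Proof.
split => //; last by move=> C; exact: coset_chartK.
by rewrite coset_chart_image; exact: openT.
Qed.

End charts.

(** * The exact sequence *)

Section smoothness.
Context {R : realType}.
Variable k : nat.
Local Notation elt := (linf R * linf R)%type.
Variables (E : normedModType R) (U : set E).
Hypothesis oU : open U.
Implicit Types f g : E -> elt.

Lemma is_Cn_fst n (F G : normedModType R) (f : E -> F * G) :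
  is_Cn n U f -> is_Cn n U (fun x => (f x).1).
Proof. exact: is_Cn_linear oU (@bounded_linear_fst _ _ _). Qed.

Lemma is_Cn_snd n (F G : normedModType R) (f : E -> F * G) :
  is_Cn n U f -> is_Cn n U (fun x => (f x).2).
Proof. exact: is_Cn_linear oU (@bounded_linear_snd _ _ _). Qed.

Lemma is_Cn_kmul n f g : is_Cn n U f -> is_Cn n U g ->
  is_Cn n U (fun x => kmul k (f x) (g x)).
Proof.
move=> fn gn; apply: (is_Cn_pair oU).
  by apply: (is_Cn_linf_mul oU); exact: is_Cn_fst.
apply: (is_CnD oU); apply: (is_Cn_linf_mul oU);
  [exact: is_Cn_fst|exact: is_Cn_snd|exact: is_Cn_snd|].
exact: (is_Cn_linear oU (@bounded_linear_shift R _)) (is_Cn_fst gn).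
Qed.

Lemma is_Cn_linf_inv_fst n f : (forall x, U x -> GI (f x)) -> is_Cn n U f ->
  is_Cn n U (fun x => linf_inv (f x).1).
Proof.
move=> fG fn; apply: (is_Cn_comp oU open_linf_pos) (is_Cn_linf_inv n) => //.
exact: is_Cn_fst.
Qed.

Lemma is_Cn_kinv n f : (forall x, U x -> GI (f x)) -> is_Cn n U f ->
  is_Cn n U (fun x => kinv k (f x)).
Proof.
move=> fG fn; apply: (is_Cn_pair oU); first exact: is_Cn_linf_inv_fst.
apply: (is_CnN oU); apply: (is_Cn_linf_mul oU).
  by apply: (is_Cn_linf_mul oU); [exact: is_Cn_linf_inv_fst|exact: is_Cn_snd].
exact: (is_Cn_linear oU (@bounded_linear_shift R _)) (is_Cn_linf_inv_fst _ fn).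
Qed.

Lemma bounded_linear_shift_periodic :
  bounded_linear (fun x : linf R => s^[k.-1] (x - periodic_part k x)).
Proof.
apply: (bounded_linear_comp (@bounded_linear_shift R k.-1)).
apply: bounded_linearD; first exact: bounded_linear_id.
exact/bounded_linearN/bounded_linear_periodic_part.
Qed.

Lemma is_Cn_coset_coord n f : (forall x, U x -> GI (f x)) -> is_Cn n U f ->
  is_Cn n U (fun x => coset_coord k (f x)).
Proof.
move=> fG fn; apply: (is_Cn_pair oU).
  apply: (is_Cn_linear oU bounded_linear_shift_periodic).
  apply: (is_Cn_comp oU open_linf_pos) (is_Cn_linf_ln n) => //.
  exact: is_Cn_fst.
by apply: (is_Cn_linf_mul oU); [exact: is_Cn_linf_inv_fst|exact: is_Cn_snd].
Qed.

Lemma is_Cn_coset_lift n f : is_Cn n U f -> is_Cn n U (fun x => coset_lift k (f x)).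
Proof.
move=> fn; have en : is_Cn n U (fun x => linf_exp (st^[k.-1] (f x).1)).
  apply: (is_Cn_comp oU openT) (is_Cn_linf_exp n) => //.
  exact: (is_Cn_linear oU (@bounded_linear_unshift R _)) (is_Cn_fst fn).
apply: (is_Cn_pair oU) => //.
by apply: (is_Cn_linf_mul oU) => //; exact: is_Cn_snd.
Qed.

End smoothness.

(** * The three Banach Lie groups and exactness of the first row *)

Section lie_groups.
Context {R : realType}.
Variable k : nat.
Local Notation elt := (linf R * linf R)%type.

Lemma GI_banach_lie_group : is_banach_lie_group (@GI_lie R k).
Proof.
split.
- exact: global_chart_banach_manifold (GI_global_chart k).
- exact: GI1.
- by split => [g h u _ _ _|g _|g _]; [exact: kmulA|exact: kmul1g|exact: kmulg1].
- by move=> g; rewrite inE => gp; split; [exact: kmulVg|exact: kmulgV].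
split.
  apply: (global_chart_smooth_map
    (global_chart_prod (GI_global_chart k) (GI_global_chart k)) (GI_global_chart k)).
    by move=> [g h] [gp hp]; exact: GI_mul.
  have [_ _ oU _] := global_chart_prod (GI_global_chart (R := R) k) (GI_global_chart k).
  move=> n; apply: (is_Cn_kmul k oU); apply: (is_Cn_bounded_linear _ oU).
    exact: bounded_linear_fst.
  exact: bounded_linear_snd.
apply: (global_chart_smooth_map (GI_global_chart k) (GI_global_chart k)).
  by move=> g gp; exact: GI_inv.
have [_ _ oU _] := GI_global_chart (R := R) k.
move=> n; apply: (is_Cn_kinv k oU); first by move=> _ [g gp <-].
exact/(is_Cn_bounded_linear _ oU)/bounded_linear_id.
Qed.

(** Replaces the chart map of [GL0], on periodic sequences, by a bounded linear map to which the
    smoothness rules apply. *)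
Lemma insubd_L0 (y : linf R) : s^[k.-1] y = y -> insubd (0 : L0 R k) y = L0_proj k y.
Proof.
move=> yk; apply: val_inj; rewrite /= L0_projE periodic_part_id//.
by rewrite insubdK//; exact/eqP.
Qed.

Lemma L0_shift (x : L0 R k) : s^[k.-1] (L0_val x) = L0_val x.
Proof. exact/eqP/(valP x). Qed.

Lemma GL0_banach_lie_group : is_banach_lie_group (@GL0_lie R k).
Proof.
have gc := @GL0_global_chart R k.
split.
- exact: global_chart_banach_manifold gc.
- exact: GL01.
- by split => [g h u _ _ _|g _|g _]; [exact: kmulA|exact: kmul1g|exact: kmulg1].
- move=> g; rewrite inE => gL; have gp := GL0_GI gL.
  by split; [exact: kmulVg|exact: kmulgV].
split.
  apply: (global_chart_smooth_map (global_chart_prod gc gc) gc).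
    by move=> [g h] [gL hL]; exact: GL0_mul.
  have [_ _ oU _] := global_chart_prod gc gc.
  move=> n; apply: (@is_Cn_ext _ _ _ _ _
    (fun x : L0 R k * L0 R k => L0_proj k (L0_val x.1 *oo L0_val x.2)) _ oU).
    move=> x _; rewrite -insubd_L0//.
    by apply: linf_ext => i; rewrite !linfE -!iter_shiftE !L0_shift.
  apply: (is_Cn_linear oU (bounded_linear_L0_proj k)).
  apply: (is_Cn_linf_mul oU); apply: (is_Cn_linear oU (@bounded_linear_L0_val R k));
    apply: (is_Cn_bounded_linear _ oU).
    exact: bounded_linear_fst.
  exact: bounded_linear_snd.
apply: (global_chart_smooth_map gc gc).
  by move=> g gL; exact: GL0_inv.
have [_ _ oU _] := gc; move=> n.
have Up : forall x, (cmap (Chart (@GL0 R k) (fun g => insubd (0 : L0 R k) g.1)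
             (fun x => (L0_val x, 0))) @` GL0 k) x -> linf_pos (L0_val x).
  by rewrite GL0_chart_image.
apply: (@is_Cn_ext _ _ _ _ _ (fun x : L0 R k => L0_proj k (linf_inv (L0_val x))) _ oU).
  move=> x; rewrite inE => /Up xp; rewrite -insubd_L0//.
  by apply: linf_ext => i; rewrite !linfE !linf_invE// -iter_shiftE L0_shift.
apply: (is_Cn_linear oU (bounded_linear_L0_proj k)).
apply: (is_Cn_comp oU open_linf_pos Up) (is_Cn_linf_inv n).
exact/(is_Cn_bounded_linear _ oU)/bounded_linear_L0_val.
Qed.

Hypothesis k_gt0 : (0 < k.-1)%N.

(** In the global chart each operation becomes: lift to [GI], operate there, take coordinates. All
    three steps are smooth. *)
Lemma GQ_banach_lie_group : is_banach_lie_group (@GQ_lie R k).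
Proof.
have gc := @GQ_global_chart R k k_gt0.
split.
- exact: global_chart_banach_manifold gc.
- by exists kone; [exact: GI1|exact: kcoset_kone].
- split => [C C' C''|C|C]; rewrite !inE /= => -[g gp <-].
  + by move=> [g' gp' <-] [g'' gp'' <-]; rewrite !kcoset_mul kmulA.
  + by rewrite -kcoset_kone kcoset_mul kmul1g.
  + by rewrite -kcoset_kone kcoset_mul kmulg1.
- move=> C; rewrite inE /= => -[g gp <-].
  by rewrite kcoset_inv// !kcoset_mul kmulVg// kmulgV// kcoset_kone.
split.
  apply: (global_chart_smooth_map (global_chart_prod gc gc) gc).
    move=> [C C'] [[g gp <-] [h hp <-]] /=; rewrite kcoset_mul.
    by exists (kmul k g h) => //; exact: GI_mul.
  have [_ _ oU _] := global_chart_prod gc gc.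
  move=> n; apply: (@is_Cn_ext _ _ _ _ _ (fun u : elt * elt =>
    coset_coord k (kmul k (coset_lift k u.1) (coset_lift k u.2))) _ oU).
    move=> u _; apply: coset_chart_coord; last exact: kcoset_mul.
    by apply: GI_mul; exact: GI_coset_lift.
  apply: (is_Cn_coset_coord k oU).
    by move=> u _; apply: GI_mul; exact: GI_coset_lift.
  apply: (is_Cn_kmul k oU); apply: (is_Cn_coset_lift k oU);
    apply: (is_Cn_bounded_linear _ oU).
    exact: bounded_linear_fst.
  exact: bounded_linear_snd.
apply: (global_chart_smooth_map gc gc).
  move=> _ [g gp <-] /=; rewrite kcoset_inv//.
  by exists (kinv k g) => //; exact: GI_inv.
have [_ _ oU _] := gc; move=> n.
apply: (@is_Cn_ext _ _ _ _ _ (fun u : elt =>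
    coset_coord k (kinv k (coset_lift k u))) _ oU).
  move=> u _; have up := GI_coset_lift k u.
  by apply: coset_chart_coord; [exact: GI_inv|exact: kcoset_inv].
apply: (is_Cn_coset_coord k oU).
  by move=> u _; apply: GI_inv; exact: GI_coset_lift.
apply: (is_Cn_kinv k oU); first by move=> u _; exact: GI_coset_lift.
apply: (is_Cn_coset_lift k oU).
exact/(is_Cn_bounded_linear _ oU)/bounded_linear_id.
Qed.

(** The differential of [coset_coord] at [g]: the logarithm contributes [g_0^-1 X_0], and the second
    component is the product rule for [g_0^-1 g_{k-1}]. *)
Definition dcoset_coord (g X : elt) : elt :=
  (s^[k.-1] (linf_inv g.1 *oo X.1 - periodic_part k (linf_inv g.1 *oo X.1)),
   linf_inv g.1 *oo X.2 + - (linf_inv g.1 *oo linf_inv g.1 *oo X.1) *oo g.2).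

Lemma is_diff_coset_coord g : GI g -> is_diff g (coset_coord k) (dcoset_coord g).
Proof.
move=> gp.
have dfst := is_diff_bounded_linear g (@bounded_linear_fst R (linf R) (linf R)).
have dsnd := is_diff_bounded_linear g (@bounded_linear_snd R (linf R) (linf R)).
apply: is_diff_pair.
  have := is_diff_compose (is_diff_compose dfst (is_diff_linf_ln gp))
    (is_diff_bounded_linear _ (bounded_linear_shift_periodic (R := R) k)).
  exact.
have := is_diff_compose (is_diff_pair (is_diff_compose dfst (is_diff_linf_inv gp)) dsnd)
  (is_diff_bilinear (linf_inv g.1, g.2) (@bounded_bilinear_linf_mul R)).
exact.
Qed.

Lemma is_diff_coset_chart g : GI g ->
  is_diff g (fun h => coset_chart k (kcoset k h)) (dcoset_coord g).
Proof.
move=> gp; apply: is_diff_near (is_diff_coset_coord gp).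
apply: filterS (open_nbhs_nbhs (conj open_GI gp)) => h hp.
by rewrite coset_chartE.
Qed.

Lemma kcoset_eq_GL0 (g : elt) : kcoset k g = GL0 k <-> GL0 k g.
Proof.
split=> [gL|gL]; first by rewrite -gL; exact: kcoset_refl.
by rewrite -(kmul1g k g) kcoset_mulr// kcoset_kone.
Qed.

Local Notation GI_chart := (@Chart elt elt (@GI R) id id).
Local Notation GL0_chart := (@Chart elt (L0 R k) (GL0 k)
  (fun g => insubd (0 : L0 R k) g.1) (fun x => (L0_val x, 0))).

Lemma bounded_linear_L0_incl :
  bounded_linear (fun y : L0 R k => (L0_val y, 0 : linf R)).
Proof.
apply: bounded_linear_pair; first exact: bounded_linear_L0_val.
split; first by move=> a x y; rewrite scaler0 addr0.
by exists 0 => x; rewrite mul0r normr0.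
Qed.

Lemma chart_diff_incl g : @chart_diff R (GL0_lie k) (GI_lie k) id GL0_chart GI_chart g
  = fun y => (L0_val y, 0).
Proof.
by have [_] := is_diff_bounded_linear (insubd (0 : L0 R k) g.1) bounded_linear_L0_incl.
Qed.

Lemma chart_diff_kcoset g : GI g ->
  @chart_diff R (GI_lie k) (GQ_lie k) (kcoset k) GI_chart (coset_chart k) g
  = dcoset_coord g.
Proof. by move=> /is_diff_coset_chart[]. Qed.

(** A right inverse of [dcoset_coord k g]: [X_0] solves [g_0^-1 X_0 = st^{k-1} u_0], and the last
    summand of [X_{k-1}] compensates the product rule. *)
Definition dcoset_section (g u : elt) : elt :=
  (g.1 *oo st^[k.-1] u.1, g.1 *oo u.2 + g.2 *oo st^[k.-1] u.1).

Lemma bounded_linear_dcoset_section g : bounded_linear (dcoset_section g).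
Proof.
have mulb (F : normedModType R) (f : F -> linf R) x : bounded_linear f ->
    bounded_linear (fun y => x *oo f y).
  by apply: bounded_linear_comp; exact/bounded_bilinearl/bounded_bilinear_linf_mul.
have st_bl : bounded_linear (fun u : elt => st^[k.-1] u.1).
  apply: bounded_linear_comp; first exact: bounded_linear_unshift.
  exact: bounded_linear_fst.
apply: bounded_linear_pair; first exact: mulb.
apply: bounded_linearD; apply: mulb => //; exact: bounded_linear_snd.
Qed.

Lemma dcoset_sectionK g : GI g -> cancel (dcoset_section g) (dcoset_coord g).
Proof.
move=> gp [u0 u1]; rewrite /dcoset_coord /dcoset_section /= linf_mulKV//.
congr pair; first by rewrite periodic_part_unshift// subr0 shift_unshift.
apply: linf_ext => n; rewrite !linfE !linf_invE//.
by field; rewrite linf_pos_neq0.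
Qed.

(** Identifies the kernel with the tangent space of [GL0]. The first coordinate vanishes iff
    [g_0^-1 v_0] equals its periodic part, that is, iff [v_0] is periodic, since [g_0] is. *)
Lemma dcoset_coord_eq0 g v : GL0 k g ->
  dcoset_coord g v = 0 <-> s^[k.-1] v.1 = v.1 /\ v.2 = 0.
Proof.
move=> [gp g2 gk]; rewrite /dcoset_coord g2 linf_mul0 addr0.
have vE : v.1 = g.1 *oo (linf_inv g.1 *oo v.1) by rewrite linf_mulVK.
split=> [v0|[v1 v2]].
  have v1 : s^[k.-1] (linf_inv g.1 *oo v.1 - periodic_part k (linf_inv g.1 *oo v.1)) = 0.
    by have := congr1 fst v0.
  have v2 : linf_inv g.1 *oo v.2 = 0 by have := congr1 snd v0.
  split; last by rewrite -(linf_mulVK v.2 gp) v2 linf_mul0.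
  have : linf_inv g.1 *oo v.1 = periodic_part k (linf_inv g.1 *oo v.1).
    apply/eqP; rewrite -subr_eq0 -unshift_shift v1; apply/eqP/linf_ext => n.
    by rewrite iter_unshiftE; case: ifP.
  move=> pE; rewrite vE pE; apply: linf_ext => n; rewrite !linfE.
  by rewrite -!(iter_shiftE k.-1) gk shift_periodic_part.
rewrite v2 linf_mul0 periodic_part_id ?subrr.
  by congr pair; apply: linf_ext => n; rewrite iter_shiftE.
apply: linf_ext => n; rewrite !linfE !linf_invE// -!(iter_shiftE k.-1).
by rewrite gk v1.
Qed.

Lemma GL0_GI_exact_GQ :
  @exact_lie_sequence R (GL0_lie k) (GI_lie k) (GQ_lie k) id (kcoset k).
Proof.
have gc := @GQ_global_chart R k k_gt0.
split.
- split; [exact: GL0_banach_lie_group|exact: GI_banach_lie_group|].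
  exact: GQ_banach_lie_group.
- split; split.
  + apply: (global_chart_smooth_map (@GL0_global_chart R k) (GI_global_chart k)).
      by move=> g /GL0_GI.
    have [_ _ oU _] := @GL0_global_chart R k; move=> n.
    exact: (is_Cn_bounded_linear _ oU) bounded_linear_L0_incl.
  + by [].
  + apply: (global_chart_smooth_map (GI_global_chart k) gc).
      by move=> g gp; exists g.
    have [_ _ oU _] := GI_global_chart (R := R) k; move=> n.
    apply: (@is_Cn_ext _ _ _ _ _ (coset_coord k) _ oU).
      by move=> g0; rewrite inE => -[g gp <-]; exact: coset_chart_coord.
    apply: (is_Cn_coset_coord k oU); first by move=> _ [g gp <-].
    exact/(is_Cn_bounded_linear _ oU)/bounded_linear_id.
  + by move=> g h _ _; exact/esym/kcoset_mul.
- split => //; rewrite image_id; apply/seteqP; split => [g gL|g [_ gL]].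
    by split; [exact: GL0_GI gL|exact/kcoset_eq_GL0].
  exact/kcoset_eq_GL0.
- split=> [g gL c d|g gp c d].
    move=> /(global_chart_at (@GL0_global_chart R k)) ->.
    move=> /(global_chart_at (GI_global_chart k)) ->.
    (* Left inverse of the differential of the inclusion: first component, then [L0_proj]. *)
    have pl := bounded_linear_comp (bounded_linear_L0_proj (R := R) k)
      (@bounded_linear_fst _ _ (linf R)).
    have [L LE Lc] := bounded_linear_pack pl.
    by exists L; split => // y; rewrite chart_diff_incl -LE /= L0_projK.
  move=> /(global_chart_at (GI_global_chart k)) -> /(global_chart_at gc) ->.
  have [L LE Lc] := bounded_linear_pack (bounded_linear_dcoset_section g).
  by exists L; split => // u; rewrite chart_diff_kcoset// -LE dcoset_sectionK.
move=> g gL c d e /(global_chart_at (@GL0_global_chart R k)) ->.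
move=> /(global_chart_at (GI_global_chart k)) -> /(global_chart_at gc) ->.
rewrite chart_diff_incl (chart_diff_kcoset (GL0_GI gL)).
apply/seteqP; split => [_ [y _ <-]|v /(dcoset_coord_eq0 _ gL)[v1 v2]].
  by apply/(dcoset_coord_eq0 _ gL); split => //=; exact: L0_shift.
exists (L0_proj k v.1) => //; rewrite L0_projE periodic_part_id//.
by rewrite -v2; case: v {v1 v2}.
Qed.

End lie_groups.

(** * Symplectic forms *)

Section summation.
Context {R : realType}.
Implicit Types (q : linf R) (r : l1 R).

Definition l1_sum r : R := limn (series r).

Lemma l1_cvg_series r : cvgn (series r).
Proof. exact/normed_cvg/l1P. Qed.

Lemma l1_sumB r r' : l1_sum (r - r') = l1_sum r - l1_sum r'.
Proof.
have rc := @l1_cvg_series r; have rc' := @l1_cvg_series r'.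
rewrite /l1_sum -lim_seriesB//.
Qed.

Lemma l1_sum_unshift m r : l1_sum (st1^[m] r) = l1_sum r.
Proof.
elim: m => //= m <-; set r' := st1^[m] r; apply/cvg_lim => //.
rewrite -cvg_shiftS; apply: cvg_trans (@l1_cvg_series r').
apply: near_eq_cvg; near=> n.
by rewrite /series/= big_nat_recl//= add0r.
Unshelve. all: by end_near. Qed.

(** Summation by parts: shift and unshift are adjoint, because leading zeros do not change a sum. *)
Lemma l1_sum_mul_unshift m q r :
  l1_sum (q *o1 st1^[m] r) = l1_sum (s^[m] q *o1 r).
Proof.
rewrite -(l1_sum_unshift m (s^[m] q *o1 r)); congr l1_sum.
apply: l1_ext => n; rewrite !(l1_mulE, iter_unshift1E) iter_shiftE.
by case: ltnP => nm; rewrite ?mulr0// subnK.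
Qed.

(** Used for operator products: the factors live on single diagonals, so each entry of the product
    has at most one nonzero term. *)
Lemma limn_series_single (f : nat -> R) l0 :
  (forall l, l != l0 -> f l = 0) -> limn (series f) = f l0.
Proof.
move=> f0; apply/cvg_lim => //; apply: cvg_near_cst.
exists l0.+1 => // n /= ln; rewrite /series/= (big_cat_nat _ (n := l0.+1))//=.
rewrite big_nat_recr//= !big_nat big1 ?add0r => [|i /andP[_ il]].
  rewrite big1 ?addr0// => i /andP[il _].
  by rewrite f0// gtn_eqF.
by rewrite f0// ltn_eqF.
Qed.

Lemma op_exp_SE m i j : op_exp (@op_S R) m i j = (j == (i + m)%N)%:R.
Proof.
elim: m i j => [|m IH] i j; first by rewrite addn0 eq_sym.
rewrite /op_exp iterS -/(op_exp _ _) /op_mul (limn_series_single (l0 := i.+1)).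
  by rewrite IH /op_S eqxx mul1r addSnnS.
by move=> l li; rewrite /op_S (negbTE li) mul0r.
Qed.

Lemma op_exp_trSE m i j : op_exp (op_tr (@op_S R)) m i j = (i == (j + m)%N)%:R.
Proof.
elim: m i j => [|m IH] i j; first by rewrite addn0.
rewrite /op_exp iterS -/(op_exp _ _) /op_mul (limn_series_single (l0 := (j + m)%N)).
  by rewrite IH eqxx mulr1 /op_tr /op_S addnS.
by move=> l lj; rewrite IH (negbTE lj) mulr0.
Qed.

Lemma Im_opE k (nu : l1 R) i j :
  Im_op k (0, nu) i j = if i == (j + k.-1)%N then nu j else 0.
Proof.
rewrite /Im_op /op_add /op_diag [X in X + _]mul0rn add0r.
rewrite /op_mul (limn_series_single (l0 := j)).
  by rewrite op_exp_trSE eqxx mulr1n; case: eqP => _; rewrite ?mul1r ?mul0r.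
by move=> l lj; rewrite (negbTE lj) mulr0n mulr0.
Qed.

Lemma Ip_opE k (b : linf R) i j :
  Ip_op k (0, b) i j = if j == (i + k.-1)%N then b i else 0.
Proof.
rewrite /Ip_op /op_add /op_diag [X in X + _]mul0rn add0r.
rewrite /op_mul (limn_series_single (l0 := i)).
  by rewrite op_exp_SE eqxx mulr1n; case: eqP => _; rewrite ?mulr1 ?mulr0.
by move=> l li; rewrite eq_sym (negbTE li) mulr0n mul0r.
Qed.

(** With [m = k.-1], the diagonal entry at [n] is [b_(n-m) nu_(n-m)] for [n >= m] and zero before,
    so the trace sums an unshifted sequence. *)
Lemma trace_Im_Ip k (nu : l1 R) (b : linf R) :
  trace (op_mul (Im_op k (0, nu)) (Ip_op k (0, b))) = l1_sum (b *o1 nu).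
Proof.
rewrite -(l1_sum_unshift k.-1) /trace /l1_sum; congr (limn (series _)).
apply/funext => n; rewrite iter_unshift1E /op_mul.
rewrite (limn_series_single (l0 := (n - k.-1)%N)) => [|l ln].
  rewrite Im_opE Ip_opE; case: ltnP => nk; last by rewrite subnK// eqxx mulrC.
  (* Subtraction is truncated: for [n < k.-1] the selected index is 0, where the second factor
     vanishes. *)
  have -> : (n - k.-1)%N = 0%N by apply/eqP; rewrite subn_eq0 ltnW.
  by rewrite add0n ltn_eqF// mul0r.
rewrite Im_opE; case: eqP => [nl|_]; last by rewrite mul0r.
by move: ln; rewrite nl addnK eqxx.
Qed.

End summation.

(** * Commutativity of the diagram and the fibres of [J_nu] *)

Section diagram.
Context {R : realType}.
Variables (k : nat) (nu : l1 R).
Local Notation elt := (linf R * linf R)%type.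

Lemma linf_exp_shiftB_ln (x : linf R) m : linf_pos x ->
  linf_exp (s^[m] (linf_ln x) - linf_ln x) = s^[m] x *oo linf_inv x.
Proof.
move=> xp; apply: linf_ext => n; rewrite !linfE !linf_lnE// linf_invE//.
by rewrite expRD expRN !lnK ?posrE ?linf_pos_gt0.
Qed.

(** Makes [iota_nu] independent of representatives: the diagonal part depends on [g] only through a
    coset coordinate, and the periodic [u.1] cancels in [s^{k-1}(g_0) g_0^-1]. *)
Lemma coAd_kmul (g u : elt) : GI g -> GL0 k u ->
  coAd k (kmul k g u) (0, nu) = coAd k g (0, nu).
Proof.
move=> gp uL; have [up _ uk] := uL; rewrite /coAd /=.
have := coset_coord_kmul gp uL => /(congr1 snd) /= ->; congr pair.
congr (_ *o1 _); apply: linf_ext => n; rewrite !linfE linf_inv_mul// !linfE !linf_invE//.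
by rewrite -!(iter_shiftE k.-1) uk; field; rewrite !linf_pos_neq0.
Qed.

Lemma iota_nuE (g : elt) : GI g -> iota_nu k nu (kcoset k g) = coAd k g (0, nu).
Proof.
move=> gp; rewrite /iota_nu.
by have [u uL ->] := get_kcoset k g; rewrite coAd_kmul.
Qed.

Lemma J_Phi_nu (g : elt) : GI g -> J_nu k nu (Phi_nu k nu g) = coAd k g (0, nu).
Proof.
move=> gp; rewrite /J_nu /Phi_nu /coAd /= linf_exp_shiftB_ln//.
by rewrite add0r [g.2 *oo _]linf_mulC.
Qed.

(** Under [Phi_nu] the action of [GL0] becomes translation of the position by [linf_ln u.1]; the
    momentum depends only on a coset coordinate. *)
Lemma Phi_nu_kmul (g u : elt) : GI g -> GL0 k u ->
  Phi_nu k nu (kmul k g u) = (linf_ln g.1 + linf_ln u.1, (Phi_nu k nu g).2).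
Proof.
move=> gp uL; have [up _ _] := uL; rewrite /Phi_nu linf_ln_mul//; congr pair.
rewrite [(kmul k g u).2 *oo _]linf_mulC [g.2 *oo _]linf_mulC.
by have := coset_coord_kmul gp uL => /(congr1 snd) /= ->.
Qed.

Lemma in_deltak_DeltaP (rho : l1 R * l1 R) :
  (@deltak R @^-1` Delta k nu) rho <->
  exists2 x : linf R, linf_pos x & rho.2 = (s^[k.-1] x *oo linf_inv x) *o1 nu.
Proof.
split=> [[g [gp g2] rhoE]|[x xp rhoE]]; first by exists g.1 => //; case: rhoE.
by exists (x, 0) => //; rewrite /deltak rhoE.
Qed.

Lemma deltak_Delta_J_nu qp : (@deltak R @^-1` Delta k nu) (J_nu k nu qp).
Proof.
apply/in_deltak_DeltaP; exists (linf_exp qp.1); first exact: linf_pos_exp.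
by rewrite /= -linf_exp_shiftB_ln ?linf_expK//; exact: linf_pos_exp.
Qed.

Lemma J_nu_onto : J_nu k nu @` setT = @deltak R @^-1` Delta k nu.
Proof.
apply/seteqP; split => [_ [qp _ <-]|rho]; first exact: deltak_Delta_J_nu.
move=> /in_deltak_DeltaP[x xp rhoE]; exists (linf_ln x, rho.1) => //.
by rewrite /J_nu /= linf_exp_shiftB_ln// -rhoE; case: rho {rhoE}.
Qed.

Hypothesis nu_neq0 : forall n, nu n != 0.

(** Genericity of [nu] enters here: its entries cancel, and injectivity of the exponential gives
    that [q' - q] is shift-invariant. *)
Lemma J_nu_fiber q p : J_nu k nu @^-1` [set J_nu k nu (q, p)] =
  [set (q + l, p) | l in L0set k].
Proof.
apply/seteqP; split => [[q' p'] JE|_ [l lk <-]].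
  have -> : p' = p := congr1 fst JE.
  exists (q' - q); last by rewrite addrC subrK.
  apply: linf_ext => n; rewrite iter_shiftE.
  have : linf_exp (s^[k.-1] q' - q') n * nu n = linf_exp (s^[k.-1] q - q) n * nu n.
    by have := congr1 (fun rho : l1 R * l1 R => rho.2 n) JE.
  move=> /(mulIf (nu_neq0 n)).
  rewrite !linfE => /expR_inj; lra.
rewrite /= /J_nu /=; congr (_, _ *o1 _); apply: linf_ext => n; rewrite !linfE.
have := congr1 (fun x : linf R => x n) lk; rewrite /= iter_shiftE => ->.
by congr expR; ring.
Qed.

(** Both sides are the translates of [Phi_nu k nu g] by periodic positions; logarithm and
    exponential pass between [GL0] and [L0set]. *)
Lemma Phi_nu_preimage (g : elt) : GI g ->
  Phi_nu k nu @` (GI `&` kcoset k @^-1` [set kcoset k g]) =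
  J_nu k nu @^-1` [set iota_nu k nu (kcoset k g)].
Proof.
move=> gp; rewrite iota_nuE// -J_Phi_nu// [Phi_nu k nu g]surjective_pairing J_nu_fiber.
apply/seteqP; split => [_ [h [hp /= gh] <-]|_ [l lk <-]].
  have [u uL ->] := (kcoset_eqP k g h).1 (esym gh).
  rewrite Phi_nu_kmul//; exists (linf_ln u.1) => //.
  by case: uL => up _ uk; rewrite /L0set /= -linf_ln_shift// uk.
have uL := GL0_exp lk.
exists (kmul k g (linf_exp l, 0)); last by rewrite Phi_nu_kmul//= linf_expK.
by split; [apply: GI_mul => //; exact: GL0_GI uL|rewrite /= kcoset_mulr].
Qed.

End diagram.

(** * The pullback of the symplectic forms *)

Section symplectic.
Context {R : realType}.
Variables (k : nat) (nu : l1 R).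
Local Notation elt := (linf R * linf R)%type.

(* [omega_nu] read in the global chart [coset_chart]: its coefficients are
   constant. *)
Definition omega_chart (u v : elt) : R :=
  l1_sum (((st^[k.-1] u.1 - u.1) *oo v.2 - (st^[k.-1] v.1 - v.1) *oo u.2) *o1 nu).

Definition dPhi_nu (g X : elt) : linf R * l1 R :=
  let a := (dcoset_coord k g X).2 *o1 nu in (linf_inv g.1 *oo X.1, a - st1^[k.-1] a).

Lemma is_diff_Phi_nu (g : elt) : GI g -> is_diff g (Phi_nu k nu) (dPhi_nu g).
Proof.
move=> gp.
have dfst := is_diff_bounded_linear g (@bounded_linear_fst R (linf R) (linf R)).
(* In this form the momentum is a bounded linear map applied to [coset_coord], so the chain rule
   gives its differential. *)
have -> : Phi_nu k nu = fun h => (linf_ln h.1,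
    (coset_coord k h).2 *o1 nu - st1^[k.-1] ((coset_coord k h).2 *o1 nu)).
  by apply/funext => h; rewrite /Phi_nu [h.2 *oo _]linf_mulC.
apply: is_diff_pair.
  have := is_diff_compose dfst (is_diff_linf_ln gp); exact.
have blin : bounded_linear (fun u : elt => u.2 *o1 nu - st1^[k.-1] (u.2 *o1 nu)).
  have nl := bounded_linear_comp (bounded_bilinearr nu (@bounded_bilinear_l1_mul R))
    (@bounded_linear_snd _ (linf R) (linf R)).
  apply: (bounded_linearD nl (bounded_linearN _)).
  exact: bounded_linear_comp (@bounded_linear_unshift1 R k.-1) nl.
have := is_diff_compose (is_diff_coset_coord k gp) (is_diff_bounded_linear _ blin).
exact.
Qed.

(** With [q = g_0^-1 X_0] and periodic part [p], the left side is [(q - p) - (s^{k-1} q - p)]. *)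
Lemma unshift_dcoset_coord (g X : elt) :
  st^[k.-1] (dcoset_coord k g X).1 - (dcoset_coord k g X).1 =
  linf_inv g.1 *oo X.1 - s^[k.-1] (linf_inv g.1 *oo X.1).
Proof.
rewrite [(dcoset_coord k g X).1]/= unshift_shift; set q := linf_inv _ *oo _.
apply: linf_ext => n; rewrite !linfE -(iter_shiftE _ (periodic_part k q)).
by rewrite shift_periodic_part; ring.
Qed.

Lemma omega_dPhi_nu (g X Y : elt) : omega (dPhi_nu g X) (dPhi_nu g Y) =
  omega_chart (dcoset_coord k g X) (dcoset_coord k g Y).
Proof.
rewrite /omega_chart !unshift_dcoset_coord /dPhi_nu.
set q := linf_inv _ *oo X.1; set q' := linf_inv _ *oo Y.1.
set a := (dcoset_coord k g X).2; set a' := (dcoset_coord k g Y).2.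
rewrite -[LHS]/(l1_sum (q *o1 (a' *o1 nu - st1^[k.-1] (a' *o1 nu))
  - q' *o1 (a *o1 nu - st1^[k.-1] (a *o1 nu)))).
(* Moves the difference operator from the momentum onto the position. *)
have parts (x : linf R) (r : l1 R) : l1_sum (x *o1 (r - st1^[k.-1] r)) =
    l1_sum ((x - s^[k.-1] x) *o1 r).
  have -> : x *o1 (r - st1^[k.-1] r) = x *o1 r - x *o1 st1^[k.-1] r.
    by apply: l1_ext => n; rewrite !(l1_mulE, l1BE) mulrBr.
  rewrite l1_sumB l1_sum_mul_unshift -l1_sumB; congr l1_sum.
  by apply: l1_ext => n; rewrite !(l1_mulE, l1BE, linfBE) mulrBl.
rewrite l1_sumB !parts -l1_sumB; congr l1_sum; apply: l1_ext => n.
by rewrite !(l1_mulE, l1BE, linfE); ring.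
Qed.

(** For [X = g o x] the second coordinate is [x_{k-1} + c (s^{k-1} x_0 - x_0)] with
    [c = g_0^-1 g_{k-1}]. The terms with [c] are symmetric in [x] and [y] and cancel, leaving the
    bracket. *)
Lemma trace_kbracket (g x y : elt) : GI g ->
  trace (op_mul (Im_op k (0, nu)) (Ip_op k (kbracket k x y))) =
  omega_chart (dcoset_coord k g (kmul k g x)) (dcoset_coord k g (kmul k g y)).
Proof.
move=> gp; rewrite trace_Im_Ip /omega_chart !unshift_dcoset_coord.
congr (l1_sum (_ *o1 _)); apply: linf_ext => n.
rewrite !linfE !linf_invE//.
by field; rewrite !linf_pos_neq0.
Qed.

Hypothesis k_gt0 : (0 < k.-1)%N.

Lemma tangent_coset_chart (g X : elt) : GI g ->
  tangent_coset k g X (coset_chart k) = dcoset_coord k g X.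
Proof.
move=> gp; rewrite /tangent_coset /tangent_map asboolT.
  by have [_ dE] := is_diff_coset_chart k gp; have := congr1 (@^~ X) dE.
by apply: (chart_at_global (GQ_global_chart k_gt0)); exists g.
Qed.

(** Each admissible triple gives a value depending only on the chart coordinates of the two tangent
    vectors, so the set under [get] is a singleton. *)
Lemma omega_nuE (g X Y : elt) : GI g ->
  omega_nu k nu (kcoset k g) (tangent_coset k g X) (tangent_coset k g Y) =
  omega_chart (dcoset_coord k g X) (dcoset_coord k g Y).
Proof.
move=> gp; rewrite /omega_nu; set S := [set t | _].
have St t : S t -> t = omega_chart (dcoset_coord k g X) (dcoset_coord k g Y).
  move=> [h [x [y [hp _ eX eY ->]]]]; rewrite (trace_kbracket _ _ hp).
  by rewrite -!tangent_coset_chart// eX eY.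
have mulK Z : kmul k g (kmul k (kinv k g) Z) = Z.
  by rewrite kmulA kmulgV// kmul1g.
(* Only nonemptiness remains; left translation by the inverse of [g] turns [X] and [Y] into Lie
   algebra elements. *)
apply/St/(@getPex _ S).
exists (trace (op_mul (Im_op k (0, nu)) (Ip_op k (kbracket k
  (kmul k (kinv k g) X) (kmul k (kinv k g) Y))))).
by exists g, (kmul k (kinv k g) X), (kmul k (kinv k g) Y); rewrite !mulK.
Qed.

End symplectic.

Theorem proposition6p3 (R : realType) (k : nat) (nu : l1 R)
    (hk : (2 <= k)%N) (hnu : forall n : nat, nu n != 0) :
  let D : set (l1 R * l1 R) := (@deltak R) @^-1` (Delta k nu) in
  [/\ (* iota_nu is well defined, and the diagram commutes *)
      [/\ forall g, GI g -> iota_nu k nu (kcoset k g) = coAd k g (0, nu),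
          set_fun (@mcarrier R (GQ_lie k)) D (iota_nu k nu) &
          forall g, GI g -> J_nu k nu (Phi_nu k nu g) = iota_nu k nu (kcoset k g) ],
      (* the first row *)
      @exact_lie_sequence R (GL0_lie k) (GI_lie k) (GQ_lie k)
        id (kcoset k),
      (* the second row *)
      J_nu k nu @` setT = D /\
      (forall rho, D rho -> exists q p,
        J_nu k nu @^-1` [set rho] = [set (q + l, p) | l in L0set k]),
      (* the symplectic forms: Phi_nu is differentiable, omega_nu satisfies
         its defining formula, and the pullbacks agree *)
      [/\ forall g : linf R * linf R, GI g -> differentiable (Phi_nu k nu) g,
          forall g x y, GI g ->
            omega_nu k nu (kcoset k g) (tangent_coset k g (kmul k g x))
              (tangent_coset k g (kmul k g y)) =
            trace (op_mul (Im_op k (0, nu)) (Ip_op k (kbracket k x y))) &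
          forall g X Y, GI g ->
            omega ('d (Phi_nu k nu) g X) ('d (Phi_nu k nu) g Y) =
            omega_nu k nu (kcoset k g) (tangent_coset k g X) (tangent_coset k g Y) ] &
      (* the last equality *)
      forall g, GI g ->
        Phi_nu k nu @` (GI `&` kcoset k @^-1` [set kcoset k g]) =
        J_nu k nu @^-1` [set iota_nu k nu (kcoset k g)] ].
Proof.
have k_gt0 : (0 < k.-1)%N by case: k hk => [|[]].
move=> D; split.
- split=> [g gp|_ [g gp <-]|g gp].
  + exact: iota_nuE.
  (* By commutativity, values of [iota_nu] are values of [J_nu]. *)
  + by rewrite iota_nuE// -J_Phi_nu//; exact: deltak_Delta_J_nu.
  + by rewrite iota_nuE// J_Phi_nu.
- exact: GL0_GI_exact_GQ.
- split=> [|rho]; first exact: J_nu_onto.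
  by rewrite /D -J_nu_onto => -[[q p] _ <-]; exists q, p; exact: J_nu_fiber.
- split=> [g gp|g x y gp|g X Y gp].
  + by have [] := is_diff_Phi_nu k nu gp.
  + by rewrite omega_nuE// (trace_kbracket _ _ _ _ gp).
  + by have [_ ->] := is_diff_Phi_nu k nu gp; rewrite omega_dPhi_nu omega_nuE.
- by move=> g; exact: Phi_nu_preimage.
Qed.
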